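(* Let $n \ge 4$ be an even integer. Then ${\sf E}(D_{2n} \times C_2) = 5n + 1$ and ${\sf d}(D_{2n} \times C_2) = n + 1$. In particular, ${\sf E}(D_{2n} \times C_2) = {\sf d}(D_{2n} \times C_2) + |D_{2n} \times C_2|$.
   Context: $D_{2n}$ is the dihedral group of order $2n$ and $C_2$ the cyclic group of order $2$. For a finite group $G$, a sequence over $G$ is a finite unordered list of elements of $G$ with repetitions allowed; for $S = g_1\cdots g_k$, $\pi(S)$ is the set of all products $g_{\tau(1)}\cdots g_{\tau(k)}$ over permutations $\tau$. A sequence is product-one free if no non-empty subsequence $T$ has $1 \in \pi(T)$. ${\sf d}(G)$ is the maximum length of a product-one free sequence over $G$. ${\sf E}(G)$ is the smallest $\ell>0$ such that every sequence over $G$ of length at least $\ell$ has a subsequence $T$ of length $|G|$ with $1 \in \pi(T)$. *)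

(* Defs.v *)
From HB Require Import structures.
From mathcomp Require Import all_boot all_fingroup all_algebra all_solvable.

Set Implicit Arguments.
Unset Strict Implicit.
Unset Printing Implicit Defensive.

Local Open Scope group_scope.

(* An unordered sequence over a group is represented by any of its listings.
   Every notion below is invariant under reordering the list: [products] ranges
   over all orderings, and the sub-multisets of a multiset are, up to
   reordering, the subsequences [subseq] of any of its listings. *)
Section Sequences.

Variable gT : finGroupType.
Implicit Types (S T : seq gT) (k l : nat).

(* $\pi(S)$ *)
Definition products S : {set gT} :=
  [set \prod_(i < size S) nth 1 S (tau i) | tau : 'S_(size S)].

Definition product_one_free S : Prop :=
  forall T, subseq T S -> T != [::] -> 1 \notin products T.

Definition has_free_length k : Prop :=
  exists2 S, size S = k & product_one_free S.

Definition forces_product_one l : Prop :=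
  0 < l /\
  (forall S, l <= size S ->
     exists T, [/\ subseq T S, size T = #|gT| & 1 \in products T]).

Lemma products_id T : \prod_(x <- T) x \in products T.
Proof.
apply/imsetP; exists 1 => //.
by rewrite (big_nth 1) big_mkord; apply: eq_bigr => i _; rewrite perm1.
Qed.

Lemma product_one_freeP S :
  reflect (product_one_free S)
    [forall m : (size S).-tuple bool,
       (mask m S != [::]) ==> (1 \notin products (mask m S))].
Proof.
apply: (iffP forallP) => [H T /subseqP[m sz ->] nT | H m].
  have szb : size m == size S by apply/eqP.
  exact: (implyP (H (Tuple szb)) nT).
by apply/implyP => nT; apply: H => //; apply: mask_subseq.
Qed.

Lemma has_free_length_dec k : decidable (has_free_length k).
Proof.
apply: (@decP _ [exists t : k.-tuple gT,
  [forall m : (size t).-tuple bool,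
     (mask m t != [::]) ==> (1 \notin products (mask m t))]]).
apply: (iffP existsP) => [[t /product_one_freeP tP] | [S sz SP]].
  by exists t; rewrite ?size_tuple.
have szb : size S == k by apply/eqP.
by exists (Tuple szb); apply/product_one_freeP.
Qed.

Lemma has_free_length_ex : exists k, has_free_length_dec k : bool.
Proof.
exists 0; apply/sumboolP; exists [::] => // T.
by rewrite subseq0 => /eqP->.
Qed.

Lemma has_free_length_bound k : (has_free_length_dec k : bool) -> k <= #|gT|.
Proof.
move=> /sumboolP[S <- SP]; rewrite leqNgt; apply/negP => ltS.
pose f (i : 'I_(size S)) := \prod_(x <- take i S) x.
have /injectivePn[i [j neq_ij eq_f]] : ~~ injectiveb f.
  apply/negP => /injectiveP/leq_card; rewrite card_ord => /(leq_trans ltS).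
  by rewrite ltnn.
wlog lt_ij : i j neq_ij eq_f / i < j.
  move=> W; case: (ltngtP i j) => [|lt_ji|/val_inj/eqP]; first exact: W.
    by apply: (W j i) => //; rewrite eq_sym.
  exact/negP.
have sz : size (take j S) = j by rewrite size_takel // ltnW.
have take_ij : take i (take j S) = take i S by rewrite take_takel // ltnW.
have /negP[] : 1 \notin products (drop i (take j S)).
  apply: SP; last by rewrite -size_eq0 size_drop sz subn_eq0 -ltnNge.
  by apply: (subseq_trans (drop_subseq _ _)); apply: take_subseq.
suff <- : \prod_(x <- drop i (take j S)) x = 1 by apply: products_id.
apply: (mulgI (f i)); rewrite mulg1 {2}eq_f /f -take_ij -big_cat.
by rewrite cat_take_drop.
Qed.

Lemma forces_product_one_dec l : decidable (forces_product_one l).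
Proof.
apply: (@decP _ ((0 < l) && [forall t : l.-tuple gT,
  [exists m : (size t).-tuple bool,
    (size (mask m t) == #|gT|) && (1 \in products (mask m t))]])).
apply: (iffP andP) => [[l_gt0 /forallP H] | [l_gt0 H]]; split => //.
  move=> S leS; have szb : size (take l S) == l by rewrite size_takel.
  have /existsP[m /andP[/eqP szT T1]] := H (Tuple szb).
  exists (mask m (take l S)); split => //.
  by apply: (subseq_trans (mask_subseq _ _)); apply: take_subseq.
apply/forallP => t.
have [|T [/subseqP[m sz ->] szT T1]] := H t; first by rewrite size_tuple.
have szb : size m == size t by apply/eqP.
by apply/existsP; exists (Tuple szb) => /=; rewrite szT eqxx.
Qed.

Lemma forces_product_one_ex : exists l, forces_product_one_dec l : bool.
Proof.
exists (#|gT| * #|gT|).+1; apply/sumboolP; split => // S ltS.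
have [g leg] : exists g, #|gT| <= count_mem g S.
  apply/existsP; apply: contraLR ltS => /existsPn H; rewrite -leqNgt.
  have -> : size S = \sum_(g : gT) count_mem g S.
    elim: S {H} => [|x S IH] /=; first by rewrite big1.
    rewrite big_split /= -IH (bigD1 x) //= eqxx big1 // => g.
    by rewrite eq_sym => /negPf->.
  rewrite -sum_nat_const; apply: leq_sum => g _.
  by apply: ltnW; rewrite ltnNge.
exists (nseq #|gT| g); rewrite size_nseq; split => //.
  apply: (@subseq_trans _ (nseq (count_mem g S) g)).
    by rewrite -(subnK leg) nseqD suffix_subseq.
  suff <- : filter (pred1 g) S = nseq (count_mem g S) g by apply: filter_subseq.
  by rewrite -size_filter; apply/all_pred1P; apply: filter_all.
suff <- : \prod_(x <- nseq #|gT| g) x = 1 by apply: products_id.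
by rewrite big_nseq iter_mulg mulg1 -cardsT expg_cardG ?inE.
Qed.

(* $\mathsf{d}(G)$: the largest [k] with [has_free_length k]; the boolean form
   required by [ex_maxn] is [has_free_length_dec]. *)
Definition small_davenport : nat :=
  ex_maxn has_free_length_ex has_free_length_bound.

(* $\mathsf{E}(G)$: the least [l] with [forces_product_one l]. *)
Definition gao_constant : nat := ex_minn forces_product_one_ex.

End Sequences.

(* In MathComp ['D_m] has order [m], and the group law of ['Z_2] is addition
   modulo 2, so that it is a cyclic group of order 2. *)
Definition dihedral_x_C2 (n : nat) : finGroupType := ('D_(2 * n) * 'Z_2)%type.

Arguments small_davenport : clear implicits.
Arguments gao_constant : clear implicits.

(* Main.v *)
From HB Require Import structures.
Require Import Defs.
From mathcomp Require Import all_boot all_fingroup all_algebra all_solvable.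
From mathcomp Require Import zify.
From Stdlib Require Import Classical_Prop.

Set Implicit Arguments.
Unset Strict Implicit.
Unset Printing Implicit Defensive.

Import GRing.Theory.
Local Open Scope ring_scope.

(* Write [G] as the generalized dihedral group of [A = C_n x C_2], with [m = n/2]
   and [2A] cyclic of order [m].  A sequence with at least one element outside [A]
   has product one in some order as soon as a signed sum vanishes: elements of [A]
   take arbitrary signs and elements outside [A] are paired into differences.
   Let [M] be a subgroup of [2A]; by induction on [#|M|], any [10 #|M| + 1]
   elements in the dihedral group over the halves of [M] contain [8 #|M|] elements
   with product one.  Greedily collect signed units as long as each enlarges the
   set of signed sums.  If these sums fill a coset of [M], one only has to discard
   elements so that the classes modulo [M], which live in [F_2^3], sum to zero.
   Otherwise their stabilizer is a proper subgroup [H] of [M], almost all the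
   remaining elements live over the halves of [H], and induction applies.  The
   sequences without elements outside [A] are settled by Gao's theorem
   [s_|B|(B) = |B| + D(B) - 1]. *)

(** * Zero-sum sequences over abelian groups *)

(** With [m = #|M|] the wanted length is [8 m] and [10 m + 1] elements are given, so an odd number,
    [2 m + 1], has to be discarded. Pairs of equal class can be discarded freely; the obstacle is
    the odd rest, which must have the class sum [w] of the whole sequence. One element of class [w]
    is enough. If there is none, then either at most three classes have odd multiplicity and pairs
    of equal class suffice, or the classes that occur are the seven other points of [F_2^3]; then a
    triple with class sum [w], a line of the Fano plane with [w] as origin, is set aside before the
    signed units are collected. In that case the bound required by the induction over the stabilizer
    is missed by exactly one element. It is recovered from a point of the triple, if one fits the
    smaller subgroup; otherwise changing the line shows that all but at most one of the remaining
    elements share a class, and the cyclicity of [2A] saves two elements. The upper bound for the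
    small Davenport constant needs no argument of its own: it follows from the one for [E]. *)

(* [simpl] identifies the different paths to the carrier of a structure. *)
Ltac slia := intros; simpl in *; lia.

Ltac perm_count :=
  apply/seq.permP => ?; do 4 rewrite /= ?count_cat; clear; lia.

Lemma perm_extract (T : eqType) (x : T) (s : seq T) :
  x \in s -> exists s', perm_eq s (x :: s').
Proof. by move=> xs; exists (rem x s); apply: perm_to_rem. Qed.

Lemma perm_extract2 (T : eqType) (x y : T) (s : seq T) :
  x \in s -> y \in s -> x != y -> exists s', perm_eq s (x :: y :: s').
Proof.
move=> xs ys nxy; have [s' ps] := perm_extract xs.
have : y \in s' by move: ys; rewrite (perm_mem ps) inE eq_sym (negPf nxy).
move=> /perm_extract[s'' ps']; exists s''.
by rewrite (perm_trans ps) // perm_cons.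
Qed.

Lemma count_complement (T : eqType) (s t : seq T) :
  (forall x, (count_mem x s <= count_mem x t)%N) ->
  exists r, perm_eq t (s ++ r).
Proof.
elim: s t => [|x s IH] t H; first by exists t.
have xt : x \in t.
  by rewrite -has_pred1 has_count (leq_trans _ (H x)) //= eqxx.
have [t' pt] := perm_extract xt; have [|r pr] := IH t'.
  by move=> y; have := H y; rewrite (seq.permP pt) /= leq_add2l.
by exists r; rewrite (perm_trans pt) //= perm_cons.
Qed.

(** Zero-sum results speak of values; this brings a splitting of the values back to the elements
    that carry them. *)
Lemma perm_map_split (T1 T2 : eqType) (f : T1 -> T2) (s : seq T1) (U R : seq T2) :
  perm_eq (map f s) (U ++ R) ->
  exists s1 s2, [/\ perm_eq s (s1 ++ s2), U = map f s1 & R = map f s2].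
Proof.
elim: U s => [|x U IH] s p.
  have [s' ps' E] : exists2 s', perm_eq s s' & R = map f s'.
    elim: R s p => [|y R IH] s p /=.
      by exists [::]; case: s p => //= z s /perm_size.
    have /mapP[z zs yE] : y \in map f s by rewrite (perm_mem p) mem_head.
    have [s' ps] := perm_extract zs.
    have [|s'' ps' ->] := IH s'.
      by move: p; rewrite (permPl (perm_map f ps)) /= yE perm_cons.
    by exists (z :: s''); rewrite ?yE // (perm_trans ps) // perm_cons.
  by exists [::], s'.
have /mapP[z zs xE] : x \in map f s by rewrite (perm_mem p) mem_head.
have [s' ps] := perm_extract zs.
have [|s1 [s2 [ps' -> ->]]] := IH s'.
  by move: p; rewrite (permPl (perm_map f ps)) /= xE perm_cons.
by exists (z :: s1), s2; rewrite xE; split => //; rewrite (perm_trans ps) // perm_cons.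
Qed.

Section ZeroSum.

Variable A : finZmodType.
Implicit Types (B X Y H M : {set A}) (S T U R N : seq A).

Definition zsub M := 0 \in M /\ {in M &, forall x y, x - y \in M}.

Definition sadd X Y : {set A} := [set x + y | x in X, y in Y].

Lemma saddP X Y z :
  reflect (exists2 x, x \in X & exists2 y, y \in Y & z = x + y)
    (z \in sadd X Y).
Proof.
apply: (iffP imset2P) => [[x y Xx Yy ->]|[x Xx [y Yy ->]]].
  by exists x => //; exists y.
by exists x y.
Qed.

Lemma zsubN M x : zsub M -> x \in M -> - x \in M.
Proof. by move=> [M0 MB] Mx; rewrite -sub0r MB. Qed.

Lemma zsubD M : zsub M -> {in M &, forall x y, x + y \in M}.
Proof. by move=> zM x y Mx My; rewrite -[y]opprK (proj2 zM) ?zsubN. Qed.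

Lemma zsub_sum M S : zsub M -> all (mem M) S -> \sum_(x <- S) x \in M.
Proof.
move=> zM; elim: S => [|x S IH] /=; first by rewrite big_nil (proj1 zM).
by case/andP=> Mx MS; rewrite big_cons zsubD // IH.
Qed.

Lemma zsubMn M x k : zsub M -> x \in M -> x *+ k \in M.
Proof.
move=> zM Mx; elim: k => [|k IH]; first by rewrite mulr0n (proj1 zM).
by rewrite mulrS zsubD.
Qed.

Lemma zsub_gt0 M : zsub M -> (0 < #|M|)%N.
Proof. by move=> [M0 _]; apply/card_gt0P; exists 0. Qed.

Lemma zsub_card_mul M x : zsub M -> x \in M -> x *+ #|M| = 0.
Proof.
move=> zM Mx; have : \sum_(y in M) y = \sum_(y in M) (y + x).
  rewrite (reindex_onto (fun y => y + x) (fun y => y - x)) /=; last first.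
    by move=> y _; rewrite subrK.
  apply: eq_bigl => y; rewrite addrK eqxx andbT.
  apply/idP/idP => H; last by rewrite zsubD.
  by rewrite -(addrK x y) (proj2 zM).
rewrite big_split /= sumr_const => /eqP; rewrite -subr_eq0 opprD addrA subrr.
by rewrite sub0r oppr_eq0 => /eqP.
Qed.

Lemma sum_sub_const (I : Type) (f : I -> A) (r : seq I) x :
  \sum_(i <- r) (f i - x) = \sum_(i <- r) f i - x *+ size r.
Proof.
elim: r => [|i r IH]; first by rewrite !big_nil mulr0n subr0.
by rewrite !big_cons IH /= mulrS opprD addrACA.
Qed.

(* Kemperman--Scherk, by the Dyson e-transform
   (X, Y) |-> (X :|: (e + Y), Y :&: (X - e)) *)
Lemma scherk X Y :
  0 \in X -> 0 \in Y ->
  {in X & Y, forall x y, x + y = 0 -> y = 0} ->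
  (#|X| + #|Y| <= #|sadd X Y| + 1)%N.
Proof.
have [k] := ubnP #|Y|; elim: k => // k IH in X Y *.
rewrite ltnS => leYk X0 Y0 XY.
have XsubXY : X \subset sadd X Y.
  by apply/subsetP => x Xx; apply/saddP; exists x => //; exists 0; rewrite ?addr0.
case: (set_0Vmem (Y :\ 0)) => [Y1|[b]].
  have -> : #|Y| = 1%N by rewrite (cardsD1 0) Y0 Y1 cards0.
  by rewrite leq_add2r subset_leq_card.
rewrite !inE => /andP[b0 Yb].
(* Were [X] closed under adding [b], it would contain all multiples of [b], among them [- b], and
   the hypothesis would give [b = 0]. *)
have [e Xe Xeb] : exists2 e, e \in X & e + b \notin X.
  apply/exists_inP; apply: contraT; rewrite negb_exists => /forallP H0.
  have H z : z \in X -> z + b \in X.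
    by move=> Xz; have := H0 z; rewrite Xz /= negbK.
  have Xb i : b *+ i \in X.
    elim: i => [|i IHi]; first by rewrite mulr0n.
    by rewrite mulrSr H.
  have := XY _ _ (Xb #|[set: A]|.-1) Yb; rewrite -mulrSr prednK; last first.
    by apply/card_gt0P; exists 0.
  rewrite zsub_card_mul ?inE //; first by move/(_ erefl)/eqP; rewrite (negPf b0).
  by split => [|? ? _ _]; rewrite inE.
pose eY : {set A} := [set e + y | y in Y].
pose X' := X :|: eY; pose Y' := [set y in Y | e + y \in X].
have ceY : #|eY| = #|Y| by rewrite card_imset //; apply: addrI.
have cI : #|X :&: eY| = #|Y'|.
  have -> : X :&: eY = [set e + y | y in Y'].
    apply/setP => z; rewrite inE; apply/andP/imsetP.
      by case=> Xz /imsetP[y Yy zE]; exists y; rewrite // inE Yy -zE.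
    by case=> y; rewrite inE => /andP[Yy Xy] ->; split => //; apply/imsetP; exists y.
  by rewrite card_imset //; apply: addrI.
have cE : (#|X'| + #|Y'| = #|X| + #|Y|)%N.
  by rewrite -cI /X' -ceY cardsUI.
have ltY : (#|Y'| < #|Y|)%N.
  apply: proper_card; apply/properP; split.
    by apply/subsetP => y; rewrite inE => /andP[].
  by exists b => //; rewrite inE Yb.
rewrite -cE; apply: leq_trans (IH X' Y' _ _ _ _) _.
- exact: leq_trans ltY leYk.
- by rewrite inE X0.
- by rewrite inE Y0 addr0.
(* For [x = e + y1] the sum regroups as [(e + y) + y1] with [e + y] in [X]; this gives [y1 = 0], and
   then [e + y = 0] gives [y = 0]. *)
- move=> x y; rewrite !inE => Hx /andP[Yy Xy] xy0; case/orP: Hx => [Xx|].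
    exact: XY xy0.
  case/imsetP=> y1 Yy1 xE; have y10 : y1 = 0.
    by apply: (XY _ _ Xy Yy1); rewrite -xy0 xE addrAC.
  by apply: (XY e y) => //; rewrite -xy0 xE y10 addr0.
rewrite leq_add2r; apply: subset_leq_card; apply/subsetP => z /saddP[x].
rewrite !inE => Hx [y]; rewrite inE => /andP[Yy Xy] ->.
case/orP: Hx => [Xx|/imsetP[y1 Yy1 ->]].
  by apply/saddP; exists x => //; exists y.
by apply/saddP; exists (e + y) => //; exists y1 => //; rewrite addrAC.
Qed.

Lemma undup_complement T :
  exists2 T', perm_eq T (undup T ++ T')
    & forall x, count_mem x T' = (count_mem x T).-1.
Proof.
have [|T' pT] := count_complement (s := undup T) (t := T).
  move=> x; rewrite count_uniq_mem ?undup_uniq // mem_undup.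
  by case: (boolP (x \in T)) => // xT; rewrite -has_count has_pred1.
exists T' => // x; rewrite (seq.permP pT) count_cat (count_uniq_mem x (undup_uniq T)).
rewrite mem_undup; case: (boolP (x \in T)) => xT //=.
have := seq.permP pT (pred1 x); rewrite count_cat (count_memPn xT).
by case: (count _ T') => // k; rewrite addnS.
Qed.


(* Either the short zero-sum exists, or Scherk's inequality applies to each
   layer of the multiset and the attainable sums become too numerous. *)
Lemma short_sums B T h : zsub B -> all (mem B) T -> 0 \notin T ->
  (forall g, (count_mem g T <= h)%N) ->
  (exists U R, [/\ perm_eq T (U ++ R), (0 < size U <= h)%N
                  & \sum_(x <- U) x = 0]) \/
  exists X, [/\ 0 \in X, X \subset B, (size T < #|X|)%N
    & forall x, x \in X -> exists U R, [/\ perm_eq T (U ++ R), (size U <= h)%N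
                  & \sum_(x <- U) x = x]].
Proof.
move=> zB; elim: h T => [|h IH] T BT T0 cT.
  have -> : T = [::].
    case: T cT {BT T0} => // x T /(_ x) /=; by rewrite eqxx.
  right; exists [set 0]; split; rewrite ?inE ?cards1 ?sub1set ?(proj1 zB) //.
  by move=> x; rewrite inE => /eqP->; exists [::], [::]; rewrite big_nil.
have [T' pT cT'] := undup_complement T.
have subT' x : x \in T' -> x \in T.
  by move=> xT'; rewrite (perm_mem pT) mem_cat xT' orbT.
have [|||[U [R [pU sU U0]]]|[X [X0 XB cX HX]]] := IH T'.
- by apply/allP => x /subT' /(allP BT).
- by apply/negP => /subT'; apply/negP.
- by move=> g; rewrite cT'; case: (count_mem g T) (cT g) => //.
- left; exists U, (R ++ undup T); split => //.
    by rewrite (perm_trans pT) // perm_catC catA perm_cat2r.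
  by case/andP: sU => -> /leqW.
have addU y x : y \in T -> x \in X ->
    exists U R, [/\ perm_eq T (y :: U ++ R), (size U <= h)%N
                   & \sum_(z <- U) z = x].
  move=> yT /HX[U [R [pU sU Ux]]].
  have [u pu] : exists u, perm_eq (undup T) (y :: u).
    by apply: perm_extract; rewrite mem_undup.
  exists U, (R ++ u); split => //; apply: (perm_trans pT).
  rewrite catA -cat1s perm_sym perm_catCA -[u]cat0s cat1s.
  rewrite perm_sym; apply: perm_trans (perm_cat pu pU) _.
  by rewrite perm_catC.
pose Y : {set A} := 0 |: [set x in T].
have cY : #|Y| = (size (undup T)).+1.
  by rewrite cardsU1 inE T0 cardsE -(card_uniqP (undup_uniq T)) (eq_card (mem_undup T)).
have [/exists_inP[x Xx /exists_inP[y yT /eqP xy0]]|/exists_inPn N] :=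
    boolP [exists x in X, [exists y in T, x + y == 0]].
  have [U [R [pU sU Ux]]] := addU _ _ yT Xx.
  left; exists (y :: U), R; split => //.
  by rewrite big_cons Ux addrC.
right; exists (sadd X Y); split.
- by apply/saddP; exists 0 => //; exists 0; rewrite ?inE ?eqxx ?addr0.
- apply/subsetP => z /saddP[x Xx [y]]; rewrite !inE => Hy ->.
  apply: zsubD => //; first exact: (subsetP XB).
  by case/orP: Hy => [/eqP->|/(allP BT) //]; rewrite (proj1 zB).
- have := scherk X0 (Y := Y); rewrite (perm_size pT) size_cat cY.
  suff XY : {in X & Y, forall x y, x + y = 0 -> y = 0}.
    by rewrite !inE eqxx => /(_ isT XY); move: cX; slia.
  move=> x y Xx; rewrite !inE => /orP[/eqP //|yT] xy0.
  by have := N x Xx; rewrite negb_exists => /forallP/(_ y); rewrite yT xy0 eqxx.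
move=> z /saddP[x Xx [y]]; rewrite !inE => /orP[/eqP->|yT] ->.
  have [U [R [pU sU Ux]]] := HX _ Xx.
  exists U, (R ++ undup T); rewrite addr0 (leqW sU); split => //.
  by rewrite (perm_trans pT) // perm_catC catA perm_cat2r.
have [U [R [pU sU Ux]]] := addU _ _ yT Xx.
by exists (y :: U), R; rewrite big_cons Ux addrC.
Qed.

Lemma short_zero_sum B T h : zsub B -> all (mem B) T -> 0 \notin T ->
  (forall g, (count_mem g T <= h)%N) -> (#|B| <= size T)%N ->
  exists U R, [/\ perm_eq T (U ++ R), (0 < size U <= h)%N
                 & \sum_(x <- U) x = 0].
Proof.
move=> zB BT T0 cT sT; case: (short_sums zB BT T0 cT) => // -[X [_ XB]].
by rewrite ltnNge (leq_trans (subset_leq_card XB)).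
Qed.

(** That is, the Davenport constant of [B] is at most [d]. *)
Definition davenport_le B d := forall T, all (mem B) T -> (d <= size T)%N ->
  exists U R, [/\ perm_eq T (U ++ R), (0 < size U)%N & \sum_(x <- U) x = 0].

Lemma davenport_card B : zsub B -> davenport_le B #|B|.
Proof.
move=> zB T BT sT; have [T0|T0] := boolP (0 \in T).
  have [R pR] := perm_extract T0.
  by exists [:: 0], R; rewrite big_seq1.
have [|U [R [pU /andP[U0 _] sU]]] := short_zero_sum (h := size T) zB BT T0 _ sT.
  by move=> g; apply: count_size.
by exists U, R.
Qed.

Lemma davenport_exhaust B d T : davenport_le B d -> all (mem B) T ->
  exists U R, [/\ perm_eq T (U ++ R), (size R < d)%N & \sum_(x <- U) x = 0].
Proof.
move=> dB; have [k] := ubnP (size T); elim: k => // k IH in T *.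
rewrite ltnS => sT BT; have [lt|ge] := ltnP (size T) d.
  by exists [::], T; rewrite big_nil.
have [U [R [pU U0 sU]]] := dB T BT ge.
move: BT sT; rewrite (perm_all _ pU) all_cat (perm_size pU) size_cat.
case/andP=> _ BR sT; have [|U' [R' [pU' sR' sU']]] := IH R _ BR; first by slia.
exists (U ++ U'), R'; split => //; last by rewrite big_cat /= sU sU' addr0.
by rewrite (perm_trans pU) // -catA perm_cat2l.
Qed.

Lemma short_exhaust B T h : zsub B -> all (mem B) T -> 0 \notin T ->
  (forall g, (count_mem g T <= h)%N) ->
  exists Us R, [/\ perm_eq T (flatten Us ++ R), (size R < #|B|)%N
    & forall u, u \in Us -> (size u <= h)%N /\ \sum_(x <- u) x = 0].
Proof.
move=> zB; have [k] := ubnP (size T); elim: k => // k IH in T *.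
rewrite ltnS => sT BT T0 cT; have [lt|ge] := ltnP (size T) #|B|.
  by exists [::], T.
have [U [R [pU /andP[U0 Uh] sU]]] := short_zero_sum zB BT T0 cT ge.
have [||||Us [R' [pUs sR' HUs]]] := IH R.
- by move: sT; rewrite (perm_size pU) size_cat; slia.
- by move: BT; rewrite (perm_all _ pU) all_cat => /andP[].
- by move: T0; rewrite (perm_mem pU) mem_cat negb_or => /andP[].
- move=> g; apply: leq_trans (cT g).
  by rewrite (seq.permP pU) count_cat leq_addl.
exists (U :: Us), R'; split => //.
  by rewrite (perm_trans pU) //= -catA perm_cat2l.
by move=> u; rewrite inE => /orP[/eqP->|/HUs].
Qed.

(* Gao's theorem once a most frequent element has been translated to [0]. *)
Lemma gao_translated B d h N : zsub B -> davenport_le B d ->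
  all (mem B) N -> 0 \notin N -> (forall g, (count_mem g N <= h)%N) ->
  (#|B| + d <= (size N + h).+1)%N ->
  exists U R, [/\ perm_eq (nseq h 0 ++ N) (U ++ R), size U = #|B|
                 & \sum_(x <- U) x = 0].
Proof.
move=> zB dB BN N0 cN sN.
(* Such a [U] is filled up to length [#|B|] with zeros, of which [h] are available. *)
suff [U [R [pU sU Uh U0]]] : exists U R, [/\ perm_eq N (U ++ R),
    (size U <= #|B|)%N, (#|B| <= size U + h)%N & \sum_(x <- U) x = 0].
  pose j := (#|B| - size U)%N; have jh : (j <= h)%N by slia.
  exists (nseq j 0 ++ U), (nseq (h - j) 0 ++ R); split.
  - rewrite -{1}(subnKC jh) nseqD -!catA perm_cat2l perm_sym perm_catCA.
    by rewrite perm_cat2l perm_sym.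
  - by rewrite size_cat size_nseq; slia.
  by rewrite big_cat /= U0 addr0 big_nseq; elim: j {jh} => //= j ->; rewrite addr0.
have [Us [R [pN sR HUs]]] := short_exhaust zB BN N0 cN.
have BR : all (mem B) R.
  by move: BN; rewrite (perm_all _ pN) all_cat => /andP[].
have [W [R' [pR sR' W0]]] := davenport_exhaust dB BR.
have sW : (size W <= #|B|)%N.
  by move: sR; rewrite (perm_size pR) size_cat; slia.
have sT : (#|B| <= size W + size (flatten Us) + h)%N.
  by move: sN; rewrite (perm_size pN) size_cat (perm_size pR) size_cat; slia.
have {}pN : perm_eq N (W ++ flatten Us ++ R').
  by rewrite (perm_trans pN) // perm_sym perm_catCA perm_cat2l perm_sym.
(* [W] is enlarged block by block. Blocks have length at most [h], so the size cannot jump over the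
   window from [#|B| - h] to [#|B|]. *)
move: HUs W0 sW sT pN; clear -Us W R' h N B.
elim: Us W R' => [|u Us IH] W R' HUs W0 sW sT pN.
  by exists W, R'; split => //; move: sT => /=; slia.
have [le|gt] := leqP #|B| (size W + h); first by exists W, (flatten (u :: Us) ++ R').
have [uh u0] := HUs u (mem_head _ _).
apply: (IH (W ++ u) R').
- by move=> v vUs; apply: HUs; rewrite inE vUs orbT.
- by rewrite big_cat /= W0 u0 addr0.
- by rewrite size_cat; slia.
- by move: sT; rewrite /= !size_cat; slia.
by rewrite (perm_trans pN) //= -!catA.
Qed.

Lemma max_mult T : T != [::] -> exists2 g, g \in T &
  forall x, (count_mem x T <= count_mem g T)%N.
Proof.
case: T => // a T _.
have [g _ Hg] := @arg_maxnP A a xpredT (fun x => count_mem x (a :: T)) isT.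
exists g; last by move=> x; apply: Hg.
rewrite -has_pred1 has_count (leq_trans _ (Hg a isT)) //.
by rewrite -has_count has_pred1 mem_head.
Qed.

(** Translation by [g] changes a sum of [#|B|] terms by [#|B|] times [g], that is by [0]. Hence a
    most frequent term may be moved to [0], where its copies serve as padding. *)
Theorem gao B d T : zsub B -> davenport_le B d -> (0 < d)%N ->
  all (mem B) T -> (#|B| + d <= (size T).+1)%N ->
  exists U R, [/\ perm_eq T (U ++ R), size U = #|B| & \sum_(x <- U) x = 0].
Proof.
move=> zB dB d_gt0 BT sT; have B_gt0 := zsub_gt0 zB.
have [|g gT Hg] := @max_mult T; first by case: (T) sT => //=; slia.
have Bg : g \in B by apply: (allP BT).
pose f x := x - g; pose N := [seq x - g | x <- T & x != g].
have pT : perm_eq (map f T) (nseq (count_mem g T) 0 ++ N).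
  rewrite {}/N; elim: (T) => //= x s IH; have [->|ne] := eqVneq x g.
    by rewrite /= /f subrr perm_cons.
  by rewrite /= add0n perm_sym -cat1s perm_catCA /= perm_cons perm_sym.
have [||||U [R [pU sU U0]]] := gao_translated (h := count_mem g T) (N := N) zB dB.
- apply/allP => z /mapP[x]; rewrite mem_filter => /andP[_ xT] ->.
  have Bx : x \in B := allP BT x xT.
  exact: (proj2 zB x g Bx Bg).
- apply/mapP => -[x]; rewrite mem_filter => /andP[ne _] /eqP.
  by rewrite eq_sym subr_eq0 (negPf ne).
- move=> x; rewrite count_map count_filter.
  apply: leq_trans (Hg (x + g)); apply: sub_count => y /= /andP[/eqP <- _].
  by rewrite subrK.
- by have := perm_size pT; rewrite size_map size_cat size_nseq addnC => <-.
have pT' : perm_eq T (map (+%R^~ g) (U ++ R)).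
  have -> : T = map (+%R^~ g) (map f T).
    by rewrite -map_comp -[LHS]map_id; apply: eq_map => x /=; rewrite subrK.
  by apply: perm_map; apply: perm_trans pT pU.
exists (map (+%R^~ g) U), (map (+%R^~ g) R); rewrite -map_cat; split => //.
  by rewrite size_map.
rewrite big_map big_split /= U0 big_const_seq count_predT sU add0r.
by rewrite -[RHS](zsub_card_mul zB Bg) -Monoid.iteropE /=; elim: #|B| => // k IH; rewrite mulrS /= IH.
Qed.

Lemma gao_multiple B d j T : zsub B -> davenport_le B d -> (0 < d)%N ->
  all (mem B) T -> (j * #|B| + d <= (size T).+1)%N ->
  exists U R, [/\ perm_eq T (U ++ R), size U = (j * #|B|)%N
                 & \sum_(x <- U) x = 0].
Proof.
move=> zB dB d_gt0; elim: j T => [|j IH] T BT sT.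
  by exists [::], T; rewrite big_nil.
have [|U [R [pU sU U0]]] := gao zB dB d_gt0 BT; first by slia.
have [||U' [R' [pR sU' U'0]]] := IH R.
- by move: BT; rewrite (perm_all _ pU) all_cat => /andP[].
- by move: sT; rewrite (perm_size pU) size_cat; slia.
exists (U ++ U'), R'; rewrite size_cat sU sU' big_cat /= U0 U'0 addr0 mulSn.
by split => //; rewrite (perm_trans pU) // -catA perm_cat2l.
Qed.

End ZeroSum.

(** * Words in generalized dihedral groups *)

(** The last pair only needs [j + 1] elements to be left, which explains the successor in the length
    bound. *)
Lemma perm_pairs (T : eqType) (r : rel T) j k (s : seq T) :
  (forall t : seq T, {subset t <= s} -> (j < size t)%N ->
     exists x y t', perm_eq t (x :: y :: t') /\ r x y) ->
  (2 * k + j <= (size s).+1)%N ->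
  exists (ps : seq (T * T)) s', [/\ size ps = k,
    perm_eq s (flatten [seq [:: p.1; p.2] | p <- ps] ++ s')
    & forall p, p \in ps -> r p.1 p.2].
Proof.
move=> H; elim: k => [|k IH] ss; first by exists [::], s.
have [|ps [s' [sps pss Hps]]] := IH; first by slia.
have spsE : size (flatten [seq [:: p.1; p.2] | p <- ps]) = (2 * k)%N.
  by rewrite -sps; elim: (ps) => //= p l ->; slia.
have [||x [y [t' [pt rxy]]]] := H s'.
- by move=> z zs'; rewrite (perm_mem pss) mem_cat zs' orbT.
- by move: ss; rewrite (perm_size pss) size_cat; slia.
exists ((x, y) :: ps), t'; split => /=; first by rewrite sps.
  rewrite (perm_trans pss) // perm_sym -[[:: x, y & _]]/([:: x; y] ++ _).
  by rewrite perm_catCA perm_cat2l perm_sym.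
by move=> p; rewrite inE => /orP[/eqP->|/Hps].
Qed.

Section Dihedral.

Variable A : finZmodType.
Implicit Types (M H B : {set A}).

Local Notation D := (bool * A)%type.
Implicit Types (S T U R : seq D) (u v : D).

(* [(e, a)] stands for [a y^e] in the generalized dihedral group of [A]. *)
Definition dihmul u v : D := (u.1 (+) v.1, if u.1 then u.2 - v.2 else u.2 + v.2).

Definition dihprod S : D := foldr dihmul (false, 0) S.

Lemma dihmulA : associative dihmul.
Proof.
move=> [e a] [f b] [g c]; rewrite /dihmul /= addbA; congr (_, _).
by case: e; case: f => /=; rewrite ?opprD ?opprK addrA.
Qed.

Lemma dihmul0 u : dihmul (false, 0) u = u.
Proof. by case: u => e a; rewrite /dihmul /= add0r. Qed.

Lemma dihprod_cat S T : dihprod (S ++ T) = dihmul (dihprod S) (dihprod T).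
Proof. by elim: S => [|u S IH] /=; rewrite ?dihmul0 // IH dihmulA. Qed.

Lemma dihprod_parity S : (dihprod S).1 = odd (count fst S).
Proof. by elim: S => //= u S ->; rewrite oddD; case: u.1. Qed.

(** The choice of an ordering is absorbed by [perm_eq]: [T] lists its elements in the order in which
    they are multiplied. *)
Definition has_block k S :=
  exists T R, [/\ perm_eq S (T ++ R), size T = k & dihprod T = (false, 0)].

Lemma has_block_perm k S S' : perm_eq S S' -> has_block k S' -> has_block k S.
Proof.
by move=> p [T [R [pT sT T1]]]; exists T, R; split => //; apply: perm_trans p pT.
Qed.

Lemma has_block_catl k S U : has_block k S -> has_block k (S ++ U).
Proof.
move=> [T [R [pT sT T1]]]; exists T, (R ++ U); split => //.
by rewrite catA perm_cat2r.
Qed.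

Lemma has_block_catr k S U : has_block k S -> has_block k (U ++ S).
Proof.
by move=> H; apply: has_block_perm (has_block_catl U H); rewrite perm_catC.
Qed.

(* [compat H S]: up to translating the elements outside [A], the elements of
   [S] lie in the subgroup generated by the halves of [H] and one element
   outside [A]. *)
Definition compat H S :=
  (forall a, (false, a) \in S -> a *+ 2 \in H) /\
  (forall b b', (true, b) \in S -> (true, b') \in S -> (b - b') *+ 2 \in H).

Lemma compat_sub H S T : {subset T <= S} -> compat H S -> compat H T.
Proof.
move=> TS [H1 H2]; split => [a /TS/H1 //|b b' /TS Hb /TS Hb']; exact: H2.
Qed.

Lemma has_block_mul H c k q S :
  (forall T, compat H T -> (c <= size T)%N -> has_block k T) ->
  compat H S -> (q * k + c <= size S + k)%N -> has_block (q * k) S.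
Proof.
move=> Hk; elim: q S => [|q IH] S cS sS; first by exists [::], S.
have [|T [R [pT sT T1]]] := Hk S cS; first by slia.
have [||T' [R' [pT' sT' T'1]]] := IH R.
- by apply: compat_sub cS => u uR; rewrite (perm_mem pT) mem_cat uR orbT.
- by move: sS; rewrite (perm_size pT) size_cat sT; slia.
exists (T ++ T'), R'; rewrite size_cat sT sT' dihprod_cat T1 T'1 dihmul0 mulSn.
by split => //; rewrite (perm_trans pT) // -catA perm_cat2l.
Qed.

(** The automorphism that fixes the abelian part and sends [y] to [t y]; it serves to move an
    element outside the abelian part to [y]. *)
Definition shift t (S : seq D) : seq D :=
  [seq (u.1, if u.1 then u.2 + t else u.2) | u <- S].

Lemma dihprod_shift t S :
  dihprod (shift t S) =
  ((dihprod S).1, if (dihprod S).1 then (dihprod S).2 + t else (dihprod S).2).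
Proof.
elim: S => //= -[e a] S; rewrite -/(shift t S) => ->.
case: e => /=; case: (dihprod S).1 => //=; rewrite /dihmul /=.
- by rewrite opprD addrACA subrr addr0.
- by rewrite addrAC.
- by rewrite addrA.
Qed.

Lemma shiftK t : cancel (shift t) (shift (- t)).
Proof.
move=> S; rewrite /shift -map_comp -[RHS]map_id; apply: eq_map => -[[] a] //=.
by rewrite addrK.
Qed.

Lemma has_block_shift t k S : has_block k (shift t S) -> has_block k S.
Proof.
move=> [T [R [pT sT T1]]]; exists (shift (- t) T), (shift (- t) R); split.
- by rewrite -{1}(shiftK t S) -map_cat; apply: perm_map.
- by rewrite size_map.
by rewrite dihprod_shift T1.
Qed.

(** Pairs with product in [M] behave like commuting letters, so Gao's theorem over [M], with [#|M|]
    as bound for the Davenport constant, selects [j * #|M|] of them. *)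
Lemma has_block_pairs M j (ps : seq (D * D)) U : zsub M ->
  (forall p, p \in ps -> exists2 a, a \in M & dihprod [:: p.1; p.2] = (false, a)) ->
  (j * #|M| + #|M| <= (size ps).+1)%N ->
  has_block (2 * (j * #|M|)) (flatten [seq [:: p.1; p.2] | p <- ps] ++ U).
Proof.
move=> zM Hps sps; pose w (p : D * D) := [:: p.1; p.2].
pose f p := (dihprod (w p)).2.
have [||V [W [pV sV V0]]] :=
  gao_multiple (j := j) (T := map f ps) zM (davenport_card zM) (zsub_gt0 zM).
- by apply/allP => _ /mapP[p /Hps[a Ma pa] ->]; rewrite /f /w pa.
- by rewrite size_map.
have [ps1 [ps2 [pps EV _]]] := perm_map_split pV.
have Hps1 p : p \in ps1 -> exists2 a, a \in M & dihprod (w p) = (false, a).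
  by move=> pps1; apply: Hps; rewrite (perm_mem pps) mem_cat pps1.
apply: has_block_catl; exists (flatten (map w ps1)), (flatten (map w ps2)); split.
- by rewrite -flatten_cat -map_cat; apply: perm_flatten; apply: perm_map.
- have -> : size (flatten (map w ps1)) = (2 * size ps1)%N.
    by elim: (ps1) => //= p l ->; slia.
  by rewrite -sV EV size_map.
suff -> : dihprod (flatten (map w ps1)) = (false, \sum_(x <- V) x) by rewrite V0.
rewrite EV; elim: (ps1) Hps1 => [|p l IH] Hl; first by rewrite /= big_nil.
rewrite [LHS](dihprod_cat (w p)) IH; last by move=> q ql; apply: Hl; rewrite inE ql orbT.
have [a _ pa] := Hl p (mem_head _ _).
have fp : f p = a by rewrite /f pa.
by rewrite pa map_cons big_cons fp.
Qed.

End Dihedral.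

(** * Classes modulo a subgroup *)

Section ElementaryAbelian.

(* The elementary abelian group of order 8; the first coordinate tells whether
   an element lies outside the abelian subgroup. *)
Definition V := (bool * (bool * bool))%type.

Definition vadd (u v : V) : V :=
  (u.1 (+) v.1, (u.2.1 (+) v.2.1, u.2.2 (+) v.2.2)).

Implicit Types (s t : seq V) (m : bitseq).

Definition bits n : seq bitseq :=
  iter n (fun l => map (cons true) l ++ map (cons false) l) [:: [::]].

Lemma mem_bits m : m \in bits (size m).
Proof.
elim: m => // b m IH; rewrite /= mem_cat.
by case: b; rewrite (map_f (cons _) IH) ?orbT.
Qed.

Definition v0 : V := (false, (false, false)).

Definition vsum (s : seq V) : V := foldr vadd v0 s.

Definition enumV : seq V :=
  [seq (a, bc) | a <- [:: false; true],
     bc <- [seq (b, c) | b <- [:: false; true], c <- [:: false; true]]].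

Lemma vsumE s : vsum s = (odd (count fst s),
  (odd (count (fun v => v.2.1) s), odd (count (fun v => v.2.2) s))).
Proof.
by elim: s => //= -[a [b c]] s ->; rewrite /vadd !oddD; case: a; case: b; case: c.
Qed.

Lemma perm_vsum s t : perm_eq s t -> vsum s = vsum t.
Proof. by move=> /seq.permP p; rewrite !vsumE !p. Qed.

Lemma vaddA : associative vadd.
Proof. by move=> [a [b c]] [d [e f]] [g [h i]]; rewrite /vadd /= !addbA. Qed.

Lemma vaddC : commutative vadd.
Proof. by move=> [a [b c]] [d [e f]]; rewrite /vadd /= addbC (addbC b) (addbC c). Qed.

Lemma vadd0 : left_id v0 vadd.
Proof. by move=> [a [b c]]. Qed.

Lemma vaddvv u : vadd u u = v0.
Proof. by case: u => [[] [[] []]]. Qed.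

Lemma vaddI u : injective (vadd u).
Proof. by move=> x y; case: u x y => [[] [[] []]] [[] [[] []]] [[] [[] []]]. Qed.

Lemma vsum_cat s t : vsum (s ++ t) = vadd (vsum s) (vsum t).
Proof. by elim: s => [|x s IH]; rewrite ?vadd0 //= IH vaddA. Qed.

Lemma mem_enumV v : v \in enumV.
Proof. by case: v => [[] [[] []]]. Qed.

Lemma uniqV_perm (s : seq V) : uniq s ->
  exists2 m, m \in bits 8
    & perm_eq s (mask m enumV).
Proof.
move=> us; exists (map (mem s) enumV).
  by exact: (mem_bits (map (mem s) enumV)).
apply: uniq_perm => //; first by apply: mask_uniq.
by move=> v; rewrite -filter_mask mem_filter mem_enumV andbT.
Qed.

(** A repetition-free sequence is, up to order, one of the 256 masks of [enumV], so a
    permutation-invariant boolean property can be settled by computation. *)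
Lemma uniqV_ind (P : pred (seq V)) :
  (forall s t, perm_eq s t -> P t -> P s) ->
  all (fun m => P (mask m enumV))
    (bits 8) ->
  forall s, uniq s -> P s.
Proof. by move=> HP /allP H s /uniqV_perm[m /H Pm /HP]; apply. Qed.

Lemma uniqV_size s : uniq s -> (size s <= 8)%N.
Proof. by move=> us; apply: (uniq_leq_size us (s2 := enumV)) => v _; apply: mem_enumV. Qed.

Definition subV (s : seq V) (P : pred (seq V)) : bool :=
  has (fun m => all (mem s) (mask m enumV) && P (mask m enumV))
    (bits 8).

Lemma perm_subV s t P : perm_eq s t -> subV t P -> subV s P.
Proof.
move=> p; apply: sub_has => m /andP[am ->]; rewrite andbT.
by apply: sub_all am => x; rewrite !inE (perm_mem p).
Qed.

Lemma subV_seq s P : subV s P ->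
  exists2 q, P q & forall r, perm_eq r s -> exists t, perm_eq r (q ++ t).
Proof.
move=> /hasP[m _ /andP[/allP ss Pm]]; exists (mask m enumV) => // r pr.
apply: count_complement => x; rewrite count_uniq_mem; last exact: mask_uniq.
case: (boolP (x \in _)) => //= /ss xs.
by rewrite -has_count has_pred1 (perm_mem pr).
Qed.

(** Five points have ten pairwise sums among seven nonzero values. Two pairs with equal sum are
    disjoint and form an affine plane. *)
Lemma uniqV_plane s : uniq s -> (4 < size s)%N ->
  subV s (fun q => (size q == 4%N) && (vsum q == v0)).
Proof.
move=> us; apply/implyP; move: s us; apply: uniqV_ind => [r t p|]; last by vm_compute.
by rewrite (perm_size p) => /implyP H; apply/implyP => /H; apply: perm_subV.
Qed.

(** All eight points sum to zero, so the sum equals that of the three missing points, which is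
    different from each of them. *)
Lemma uniqV_sum5 s : uniq s -> size s = 5%N -> vsum s \in s.
Proof.
move=> us /eqP; apply/implyP; move: s us; apply: uniqV_ind => [r t p|]; last by vm_compute.
by rewrite (perm_size p) (perm_vsum p) (perm_mem p).
Qed.

(** The sum is the missing point. Taken as origin, it turns the seven points into the Fano plane,
    whose lines are the triples with this sum; at most one of the four points outside the abelian
    part is missing. *)
Lemma uniqV_line s : uniq s -> size s = 7%N ->
  (2 < count fst s)%N && subV s (fun q => (size q == 3%N) && (vsum q == vsum s)).
Proof.
move=> us /eqP; apply/implyP; move: s us; apply: uniqV_ind => [r t p|]; last by vm_compute.
rewrite (perm_size p) (perm_vsum p) (seq.permP p).
by move=> /implyP H; apply/implyP => /H /andP[-> /=]; apply: perm_subV.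
Qed.

(** The sum of three of the four points of [F_2^2] is the fourth, so it vanishes unless [v0] is
    among the three. *)
Lemma uniqV_triangle s : uniq s -> size s = 3%N -> ~~ has fst s ->
  (v0 \in s) || (vsum s == v0).
Proof.
move=> us s3 nf; suff: (size s == 3) && ~~ has fst s ==> (v0 \in s) || (vsum s == v0).
  by rewrite s3 nf.
move: s us {s3 nf}; apply: uniqV_ind => [r t p|]; last by vm_compute.
by rewrite (perm_size p) (perm_vsum p) (perm_mem p) (eq_has_r (perm_mem p)).
Qed.

(* Two points of the Fano plane off a line span, together with a point of
   that line, another line; the deleted point is the common sum [w]. *)
Lemma fano (y1 y2 y3 p q : V) : let w := vsum [:: y1; y2; y3] in
  w \notin [:: y1; y2; y3; p; q] -> p != q ->
  [|| p \in [:: y1; y2; y3], q \in [:: y1; y2; y3]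
    | vadd w (vadd p q) \in [:: y1; y2; y3]].
Proof.
have : all (fun y1 => all (fun y2 => all (fun y3 => all (fun p => all (fun q =>
  (vsum [:: y1; y2; y3] \notin [:: y1; y2; y3; p; q]) ==> (p != q) ==>
  [|| p \in [:: y1; y2; y3], q \in [:: y1; y2; y3]
    | vadd (vsum [:: y1; y2; y3]) (vadd p q) \in [:: y1; y2; y3]])
  enumV) enumV) enumV) enumV) enumV by vm_compute.
move=> /allP/(_ y1 (mem_enumV _)) /allP/(_ y2 (mem_enumV _)).
move=> /allP/(_ y3 (mem_enumV _)) /allP/(_ p (mem_enumV _)).
by move=> /allP/(_ q (mem_enumV _)) /implyP H w /H /implyP.
Qed.

End ElementaryAbelian.

(** * The quotient of [halves M] by [M], of exponent two *)

Section Classes.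

Variable A : finZmodType.
Implicit Types (M H B N : {set A}).

Definition halves M : {set A} := [set a | a *+ 2 \in M].

Lemma zsub_halves M : zsub M -> zsub (halves M).
Proof.
move=> zM; split=> [|x y]; rewrite !inE ?mul0rn ?(proj1 zM) // => Mx My.
by rewrite mulrnBl (proj2 zM).
Qed.

Lemma zsub_translateU B N e : zsub B -> zsub N -> N \subset B ->
  e \in B -> e \notin N -> e *+ 2 \in N ->
  [/\ zsub (N :|: [set e + x | x in N]), N :|: [set e + x | x in N] \subset B
    & #|N :|: [set e + x | x in N]| = (2 * #|N|)%N].
Proof.
move=> zB zN NB Be Ne N2; have N1 x : (x \in [set e + z | z in N]) = (x - e \in N).
  apply/imsetP/idP => [[z Nz ->]|Nx]; first by rewrite addrAC subrr add0r.
  by exists (x - e); rewrite // addrCA subrr addr0.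
split.
- split=> [|x y]; rewrite !in_setU ?(proj1 zN) // !N1.
  case/orP=> Hx; case/orP=> Hy; apply/orP.
  + by left; apply: (proj2 zN).
  + right; rewrite (_ : x - y - e = x - (y - e) - e *+ 2); last first.
      by rewrite opprB mulr2n opprD !addrA [x + e - y]addrAC addrK.
    by apply: (proj2 zN) => //; apply: (proj2 zN).
  + by right; rewrite addrAC (proj2 zN).
  + left; have -> : x - y = (x - e) - (y - e) by rewrite [- (y - e)]opprB addrA subrK.
    exact: (proj2 zN).
- apply/subsetP => x; rewrite in_setU N1 => /orP[/(subsetP NB) //|/(subsetP NB) Bx].
  by rewrite -(subrK e x) zsubD.
rewrite cardsU card_imset; last exact: addrI.
rewrite (_ : N :&: _ = set0) ?cards0; first by rewrite subn0 mul2n addnn.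
apply/setP => x; rewrite in_setI N1 in_set0; apply/negP => /andP[Nx Nxe].
by move/negP: Ne; apply; rewrite -(subKr x e) (proj2 zN).
Qed.

Lemma index2_addb B N a b : zsub B -> zsub N -> N \subset B ->
  #|B| = (2 * #|N|)%N -> a \in B -> b \in B ->
  (a + b \notin N) = (a \notin N) (+) (b \notin N).
Proof.
move=> zB zN NB cB Ba Bb; have [Na|Na] := boolP (a \in N); have [Nb|Nb] := boolP (b \in N).
- by rewrite zsubD.
- apply/negP => Nab; case/negP: Nb; by rewrite -(addKr a b) addrC (proj2 zN).
- apply/negP => Nab; case/negP: Na; by rewrite -(addrK b a) (proj2 zN).
(* If twice [a] were outside [N], the three cosets of [0], [a] and [a *+ 2] would be disjoint in
   [B], against index two. *)
have [N2|N2] := boolP (a *+ 2 \in N); last first.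
  pose X := N :|: [set a + x | x in N]; pose Y := [set a *+ 2 + x | x in N].
  have XB : X :|: Y \subset B.
    apply/subsetP => x; rewrite !in_setU => /orP[/orP[/(subsetP NB) //|]|] /imsetP[z /(subsetP NB) Bz ->].
      exact: zsubD.
    by apply: zsubD => //; apply: zsubMn.
  have d1 : N :&: [set a + x | x in N] = set0.
    apply/setP => x; rewrite in_setI in_set0; apply/negP => /andP[Nx /imsetP[z Nz E]].
    by case/negP: Na; rewrite -(addrK z a) -E (proj2 zN).
  have d2 : X :&: Y = set0.
    apply/setP => x; rewrite in_setI in_set0 in_setU.
    apply/negP => /andP[/orP[Nx|/imsetP[z' Nz' E']] /imsetP[z Nz E]].
      by case/negP: N2; rewrite -(addrK z (a *+ 2)) -E (proj2 zN).
    case/negP: Na; have -> : a = z' - z; last by apply: (proj2 zN).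
    apply/eqP; rewrite eq_sym subr_eq; apply/eqP; apply: (addrI a).
    by rewrite -E' E mulr2n addrA.
  have := subset_leq_card XB; have N0 := zsub_gt0 zN.
  rewrite cardsU d2 cards0 cardsU d1 cards0 !card_imset; [|exact: addrI..].
  by rewrite cB => H; exfalso; move: H N0; move: #|N| => k; lia.
have [zX XB cX] := zsub_translateU zB zN NB Ba Na N2.
have : b \in N :|: [set a + x | x in N].
  by have /eqP-> : N :|: [set a + x | x in N] == B; rewrite ?eqEcard ?XB ?cX ?cB /=.
rewrite in_setU (negPf Nb) => /imsetP[z Nz ->].
by rewrite addrA -mulr2n zsubD.
Qed.

Variable M : {set A}.
Hypothesis zM : zsub M.
Hypothesis cM : #|halves M| = (4 * #|M|)%N.

(** The two coordinates test membership in two subgroups of index two that meet in [M]; each is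
    generated over [M] by one further element. *)
Lemma class_map : exists c : A -> bool * bool,
  {in halves M &, forall a b, c (a + b) = ((c a).1 (+) (c b).1, (c a).2 (+) (c b).2)}
  /\ {in halves M, forall a, (c a == (false, false)) = (a \in M)}.
Proof.
pose B := halves M; have zB : zsub B := zsub_halves zM.
have M0 := zsub_gt0 zM.
have MB : M \subset B by apply/subsetP => x Mx; rewrite inE zsubMn.
have pick2 N : zsub N -> (#|N| < #|B|)%N -> exists2 e, e \in B & e \notin N.
  move=> zN; rewrite ltnNge => /negP H; apply/exists_inP; apply: contraT.
  rewrite negb_exists => /forallP HN; case: H; apply: subset_leq_card.
  by apply/subsetP => x Bx; have := HN x; rewrite Bx negbK.
have [e1 Be1 Me1] : exists2 e, e \in B & e \notin M.
  by apply: pick2 => //; rewrite cM; slia.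
have B2 e : e \in B -> e *+ 2 \in M by rewrite inE.
have [zM1 M1B cM1] := zsub_translateU zB zM MB Be1 Me1 (B2 _ Be1).
set M1 := _ :|: _ in zM1 M1B cM1.
have [e2 Be2 Me2] : exists2 e, e \in B & e \notin M1.
  by apply: pick2 => //; rewrite cM cM1; slia.
have Me2' : e2 \notin M by apply: contra Me2 => H; rewrite in_setU H.
have [zM2 M2B cM2] := zsub_translateU zB zM MB Be2 Me2' (B2 _ Be2).
set M2 := _ :|: _ in zM2 M2B cM2.
have c1 : #|B| = (2 * #|M1|)%N by rewrite cM cM1; slia.
have c2 : #|B| = (2 * #|M2|)%N by rewrite cM cM2; slia.
exists (fun a => (a \notin M1, a \notin M2)); split => [a b Ba Bb|a Ba] /=.
  by rewrite (index2_addb zB zM1 M1B c1 Ba Bb) (index2_addb zB zM2 M2B c2 Ba Bb).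
rewrite xpair_eqE !eqbF_neg !negbK; apply/andP/idP => [[]|Ma]; last by rewrite !in_setU Ma.
rewrite !in_setU => /orP[//|/imsetP[x Mx ax]] /orP[//|/imsetP[y My ay]].
case/negP: Me2; rewrite in_setU; apply/orP; right; apply/imsetP.
exists (x - y); first exact: (proj2 zM).
by rewrite addrA -ax ay addrK.
Qed.

End Classes.

(** * Signed sums *)

Section SignedSums.

Variable A : finZmodType.
Implicit Types (M H B X Y Z : {set A}) (vs : seq A).

Lemma saddA : associative (@sadd A).
Proof.
move=> X Y Z; apply/setP => t; apply/saddP/saddP.
  case=> x Xx [_ /saddP[y Yy [z Zz ->]] ->]; exists (x + y).
    by apply/saddP; exists x => //; exists y.
  by exists z; rewrite ?addrA.
case=> _ /saddP[x Xx [y Yy ->]] [z Zz ->]; exists x => //.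
by exists (y + z); rewrite ?addrA //; apply/saddP; exists y => //; exists z.
Qed.

Lemma saddC : commutative (@sadd A).
Proof.
suff H X Y : sadd X Y \subset sadd Y X.
  by move=> X Y; apply/eqP; rewrite eqEsubset !H.
apply/subsetP => _ /saddP[x Xx [y Yy ->]]; apply/saddP.
by exists y => //; exists x; rewrite // addrC.
Qed.

Lemma sadd0 : left_id [set 0] (@sadd A).
Proof.
move=> X; apply/setP => t; apply/saddP/idP => [[_ /set1P-> [x Xx ->]]|Xt].
  by rewrite add0r.
by exists 0; rewrite ?inE //; exists t; rewrite ?add0r.
Qed.

HB.instance Definition _ :=
  Monoid.isComLaw.Build {set A} [set 0] (@sadd A) saddA saddC sadd0.

Definition sg vs : {set A} := \big[@sadd A/[set 0]]_(v <- vs) [set v; - v].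

Lemma sg_nil : sg [::] = [set 0].
Proof. exact: big_nil. Qed.

Lemma sg_cat vs ws : sg (vs ++ ws) = sadd (sg vs) (sg ws).
Proof. exact: big_cat. Qed.

Lemma perm_sg vs ws : perm_eq vs ws -> sg vs = sg ws.
Proof. exact: perm_big. Qed.

Lemma sg_consP v vs t :
  reflect (exists2 s, s \in sg vs & t = v + s \/ t = - v + s) (t \in sg (v :: vs)).
Proof.
rewrite /sg big_cons -/(sg vs); apply: (iffP (saddP _ _ _)).
  by case=> x /set2P[]-> [s Hs ->]; exists s => //; [left|right].
by case=> s Hs [->|->]; [exists v|exists (- v)]; rewrite ?in_set2 ?eqxx ?orbT //; exists s.
Qed.

Lemma sum_sg vs : \sum_(v <- vs) v \in sg vs.
Proof.
elim: vs => [|v vs IH]; first by rewrite big_nil sg_nil inE.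
by rewrite big_cons; apply/sg_consP; exists (\sum_(v <- vs) v) => //; left.
Qed.

Definition stab X : {set A} := [set t | [forall x in X, t + x \in X]].

Lemma stabP X t : reflect {in X, forall x, t + x \in X} (t \in stab X).
Proof. by rewrite inE; apply: (iffP forall_inP). Qed.

Lemma zsub_stab X : zsub (stab X).
Proof.
split=> [|s t /stabP Hs /stabP Ht]; first by apply/stabP => x; rewrite add0r.
apply/stabP => x Xx; have E : [set t + x | x in X] = X.
  apply/eqP; rewrite eqEcard card_imset; last exact: addrI.
  by rewrite leqnn andbT; apply/subsetP => _ /imsetP[y Xy ->]; apply: Ht.
move: Xx; rewrite -{1}E => /imsetP[y Xy ->].
by rewrite addrA subrK Hs.
Qed.

(** Up to translation by [- v], adding [v] replaces a set [X] of signed sums by the union of [X] and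
    [v *+ 2 + X]. *)
Lemma card_sg_grow v vs : v *+ 2 \notin stab (sg vs) -> (#|sg vs| < #|sg (v :: vs)|)%N.
Proof.
move=> Hv; have [x Xx Nx] : exists2 x, x \in sg vs & v *+ 2 + x \notin sg vs.
  by move: Hv; rewrite inE negb_forall => /existsP[x]; rewrite negb_imply => /andP[]; exists x.
have <- : #|[set - v + y | y in (v *+ 2 + x) |: sg vs]| = #|sg vs|.+1.
  by rewrite card_imset ?cardsU1 ?Nx //; apply: addrI.
apply: subset_leq_card; apply/subsetP => _ /imsetP[y Hy ->]; apply/sg_consP.
case/setU1P: Hy => [->|Xy]; last by exists y => //; right.
by exists x => //; left; rewrite addrA mulr2n addKr.
Qed.

Variable M : {set A}.
Hypothesis zM : zsub M.

(** Changing the sign of [v] changes the sum by [v *+ 2], an element of [M]. *)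
Lemma sg_coset vs t : all (mem (halves M)) vs -> t \in sg vs ->
  t - \sum_(v <- vs) v \in M.
Proof.
elim: vs t => [|v vs IH] t; first by rewrite sg_nil => _ /set1P->; rewrite big_nil subr0 (proj1 zM).
move=> /= /andP[Mv Mvs] /sg_consP[s /(IH _ Mvs) Hs]; rewrite big_cons => -[] ->.
  by rewrite opprD addrACA subrr add0r.
rewrite opprD addrACA -opprD -mulr2n zsubD // zsubN //.
by move: Mv; rewrite !inE.
Qed.

Lemma sg_neq0 vs : exists x, x \in sg vs.
Proof. by exists (\sum_(v <- vs) v); apply: sum_sg. Qed.

Lemma stab_sg_sub vs : all (mem (halves M)) vs -> stab (sg vs) \subset M.
Proof.
move=> Mvs; have [x Xx] := sg_neq0 vs; apply/subsetP => t /stabP Ht.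
have := (proj2 zM) _ _ (sg_coset Mvs (Ht _ Xx)) (sg_coset Mvs Xx).
by rewrite opprB addrA subrK addrK.
Qed.

Let coset (s : A) : {set A} := [set s + x | x in M].

Lemma mem_coset s t : (t \in coset s) = (t - s \in M).
Proof.
apply/imsetP/idP => [[x Mx ->]|Mt]; first by rewrite addrAC subrr add0r.
by exists (t - s); rewrite // addrCA subrr addr0.
Qed.

Lemma card_coset s : #|coset s| = #|M|.
Proof. by rewrite card_imset //; apply: addrI. Qed.

Lemma sg_sub_coset vs : all (mem (halves M)) vs -> sg vs \subset coset (\sum_(v <- vs) v).
Proof. by move=> Mvs; apply/subsetP => t Ht; rewrite mem_coset sg_coset. Qed.

Lemma card_sg_le vs : all (mem (halves M)) vs -> (#|sg vs| <= #|M|)%N.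
Proof. by move=> /sg_sub_coset/subset_leq_card; rewrite card_coset. Qed.

Lemma sg_full vs t : all (mem (halves M)) vs -> (#|M| <= #|sg vs|)%N ->
  t - \sum_(v <- vs) v \in M -> t \in sg vs.
Proof.
move=> Mvs le; rewrite -mem_coset; suff /eqP-> : sg vs == coset (\sum_(v <- vs) v) by [].
by rewrite eqEcard sg_sub_coset //= card_coset.
Qed.

(** The signed sums form a union of cosets of their stabilizer, so together with one point of the
    coset of [M] they miss a full coset of the stabilizer. *)
Lemma sg_not_full vs : all (mem (halves M)) vs -> (#|sg vs| < #|M|)%N ->
  (#|sg vs| + #|stab (sg vs)| <= #|M|)%N.
Proof.
move=> Mvs lt; set X := sg vs; pose s := \sum_(v <- vs) v.
have [y Cy Xy] : exists2 y, y \in coset s & y \notin X.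
  apply/exists_inP; apply: contraT; rewrite negb_exists => /forallP H.
  move: lt; rewrite ltnNge -(card_coset s) subset_leq_card //.
  by apply/subsetP => y Cy; have := H y; rewrite Cy negbK.
pose Y : {set A} := [set t + y | t in stab X].
have cY : #|Y| = #|stab X| by rewrite card_imset //; apply: addIr.
have dXY : X :&: Y = set0.
  apply/setP => z; rewrite in_setI in_set0; apply/negP => /andP[Xz /imsetP[t Ht E]].
  case/negP: Xy; have /stabP/(_ z Xz) : - t \in stab X by apply: zsubN Ht; apply: zsub_stab.
  by rewrite E addKr.
have : X :|: Y \subset coset s.
  rewrite subUset sg_sub_coset //=; apply/subsetP => _ /imsetP[t Ht ->].
  rewrite mem_coset -addrA zsubD -?mem_coset //.
  by apply: (subsetP (stab_sg_sub Mvs)).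
by move/subset_leq_card; rewrite cardsU dXY cards0 subn0 cY card_coset.
Qed.

End SignedSums.

(** * Signed units and their greedy collection *)

Section Growth.

Variable A : finZmodType.
Implicit Types (M H : {set A}).
Local Notation D := (bool * A)%type.
Implicit Types (S T U R x : seq D) (F : seq (seq D)).

(* The units of length at most two that carry a sign: an element of the abelian
   part, or a pair of elements outside it. *)
Definition unit_block x : bool :=
  if x is [:: u] then ~~ u.1 else if x is [:: u; v] then u.1 && v.1 else false.

Definition bval x : A := (dihprod x).2.

Lemma unit_block_ind (P : seq D -> Prop) :
  (forall a, P [:: (false, a)]) -> (forall b b', P [:: (true, b); (true, b')]) ->
  forall x, unit_block x -> P x.
Proof. by move=> H1 H2 [|[[] a] [|[[] b] [|? ?]]]. Qed.

Lemma bval1 a : bval [:: (false, a)] = a.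
Proof. by rewrite /bval /= addr0. Qed.

Lemma bval2 b b' : bval [:: (true, b); (true, b')] = b - b'.
Proof. by rewrite /bval /= subr0. Qed.

Local Notation ins := (map (pair false)).

Lemma dihprod_ins (P : seq A) : dihprod (ins P) = (false, \sum_(a <- P) a).
Proof. by elim: P => [|a P IH] /=; rewrite ?big_nil // IH big_cons. Qed.

(** A pair outside the abelian part realises either sign by its order and goes to [Q]. A negative
    abelian element cannot be inverted on its own; it is kept in [N], to be conjugated later. *)
Lemma signed_decomposition F t : all unit_block F -> t \in sg (map bval F) ->
  exists P N Q r, [/\ perm_eq (flatten F) (ins P ++ ins N ++ Q),
    dihprod Q = (false, r) & t = \sum_(a <- P) a - \sum_(a <- N) a + r].
Proof.
elim: F t => [|x F IH] t /=.
  rewrite sg_nil => _ /set1P->; exists [::], [::], [::], 0.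
  by rewrite big_nil subrr addr0.
case/andP=> xb Fb /sg_consP[s /(IH _ Fb)[P [N [Q [r [pF Qr sE]]]]]].
elim/unit_block_ind: x / xb => [a|b b']; rewrite ?bval1 ?bval2 => tE.
- case: tE => ->.
    exists (a :: P), N, Q, r; rewrite big_cons sE !addrA; split => //=.
    by rewrite perm_cons.
  exists P, (a :: N), Q, r; rewrite big_cons sE; split => //=.
    by rewrite perm_sym -cat1s perm_catCA perm_cons perm_sym.
  by rewrite opprD !addrA [- a + _]addrC.
have pF' c c' : perm_eq ([:: c; c'] ++ flatten F) (ins P ++ ins N ++ [:: c; c'] ++ Q).
  apply: (@perm_trans _ ([:: c; c'] ++ ins P ++ ins N ++ Q)).
    by rewrite perm_cat2l.
  by rewrite perm_catCA perm_cat2l perm_catCA.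
case: tE => ->.
  exists P, N, ([:: (true, b); (true, b')] ++ Q), (b - b' + r); split => //.
    by rewrite dihprod_cat Qr /= /dihmul /= subr0.
  by rewrite sE addrCA.
exists P, N, ([:: (true, b'); (true, b)] ++ Q), (b' - b + r); split => //.
- apply: perm_trans (pF' _ _).
  by rewrite -[_ :: _]/([:: _; _] ++ _) perm_cat2r (perm_catC [:: _] [:: _]).
- by rewrite dihprod_cat Qr /= /dihmul /= subr0.
by rewrite sE opprB addrCA.
Qed.

(* The word is [b N b' P Q]: the elements of [N] are inverted by [b] and [b']. *)
Lemma signed_word b b' F : all unit_block F ->
  0 \in sg (b - b' :: map bval F) ->
  exists T, perm_eq ((true, b) :: (true, b') :: flatten F) T /\ dihprod T = (false, 0).
Proof.
move=> Fb; have word c c' s : s \in sg (map bval F) -> c - c' + s = 0 ->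
    exists T, perm_eq ((true, c) :: (true, c') :: flatten F) T /\ dihprod T = (false, 0).
  move=> /(signed_decomposition Fb)[P [N [Q [r [pF Qr ->]]]]] E.
  exists ((true, c) :: ins N ++ (true, c') :: ins P ++ Q); split.
    rewrite perm_cons -cat1s perm_sym -[(true, c') :: _]cat1s perm_catCA.
    by rewrite perm_cat2l perm_catCA perm_sym.
  rewrite /= !(dihprod_cat, dihprod_ins) /= dihprod_cat dihprod_ins Qr /dihmul /=.
  congr (_, _); rewrite -[RHS]E opprD opprB.
  by rewrite !addrA [LHS](ACl (1*5*3*2*4)%AC).
case/sg_consP=> s Fs [E|E]; first by apply: (word b b' s Fs).
have [|T [pT T1]] := word b' b s Fs _; first by rewrite E opprB.
exists T; split => //; apply: perm_trans pT.
by rewrite (perm_cat2r (flatten F) [:: _; _] [:: _; _]) (perm_catC [:: _] [:: _]).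
Qed.

Lemma unit_blocks_of U : ~~ odd (count fst U) ->
  exists2 G, all unit_block G & perm_eq U (flatten G).
Proof.
have [k] := ubnP (size U); elim: k => // k IH in U *; case: U => [|[e a] U].
  by exists [::].
rewrite ltnS /= => sU; case: e => /= [oU|/IH[//|G Gb pU]]; last first.
  by exists ([:: (false, a)] :: G); rewrite //= perm_cons.
have /hasP[[[] b] bU //] : has fst U.
  by rewrite has_count; case: (count fst U) oU.
move=> _; have [U' pU] := perm_extract bU.
have [||G Gb pG] := IH U'.
- by move: sU; rewrite (perm_size pU); slia.
- by move: oU; rewrite (seq.permP pU) /= !negbK.
exists ([:: (true, a); (true, b)] :: G) => //=.
by rewrite perm_cons (perm_trans pU) // perm_cons.
Qed.

(** A pair contributes [b - b'] in place of [b + b'], and the difference, twice [b'], lies in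
    [M]. *)
Lemma sum_bval M F : zsub M -> all unit_block F ->
  {in flatten F, forall u, u.2 \in halves M} ->
  \sum_(v <- map bval F) v - \sum_(u <- flatten F) u.2 \in M.
Proof.
move=> zM; elim: F => [|x F IH] /=; first by rewrite !big_nil subrr (proj1 zM).
case/andP=> xb Fb HF; rewrite big_cons big_cat /= opprD addrACA zsubD //; last first.
  by apply: IH => // u uF; apply: HF; rewrite mem_cat uF orbT.
have {}HF u : u \in x -> u.2 \in halves M by move=> ux; apply: HF; rewrite mem_cat ux.
elim/unit_block_ind: x / xb HF => [a|b b'] HF.
  by rewrite bval1 big_seq1 subrr (proj1 zM).
have := HF (true, b'); rewrite !inE eqxx orbT => /(_ isT) Mb'.
by rewrite bval2 big_cons big_seq1 /= opprD addrACA subrr add0r -opprD zsubN //.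
Qed.

Lemma unit_blocks_halves M F : zsub M -> all unit_block F ->
  {in flatten F, forall u, u.2 \in halves M} -> all (mem (halves M)) (map bval F).
Proof.
move=> zM; elim: F => [|x F IH] //= /andP[xb Fb] HF; apply/andP; split; last first.
  by apply: IH => // u uF; apply: HF; rewrite mem_cat uF orbT.
have {}HF u : u \in x -> u.2 \in halves M by move=> ux; apply: HF; rewrite mem_cat ux.
elim/unit_block_ind: x / xb HF => [a|b b'] HF.
  by rewrite bval1; apply: (HF (false, a)); rewrite mem_head.
rewrite bval2; apply: (proj2 (zsub_halves zM)).
  by apply: (HF (true, b)); rewrite mem_head.
by apply: (HF (true, b')); rewrite !inE eqxx orbT.
Qed.

Lemma count_unit_blocks F : all unit_block F -> odd (count fst (flatten F)) = false.
Proof.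
elim: F => [|x F IH] //= /andP[xb /IH E]; rewrite count_cat oddD E addbF.
by elim/unit_block_ind: x / xb.
Qed.

(** The units formed from [U] all take the sign plus; the signs in [F] then compensate, because the
    signed sums of [F] fill the coset of [M] that contains the required value. *)
Lemma full_word M F U : zsub M -> all unit_block F ->
  {in flatten F ++ U, forall u, u.2 \in halves M} ->
  (#|M| <= #|sg (map bval F)|)%N -> ~~ odd (count fst (flatten F ++ U)) ->
  has fst (flatten F ++ U) -> \sum_(u <- flatten F ++ U) u.2 \in M ->
  exists T, perm_eq (flatten F ++ U) T /\ dihprod T = (false, 0).
Proof.
move=> zM Fb HFU full ev hs sM.
have [|G Gb pU] := @unit_blocks_of U.
  by move: ev; rewrite count_cat oddD count_unit_blocks.
have pE : perm_eq (flatten F ++ U) (flatten (G ++ F)).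
  by rewrite flatten_cat perm_sym perm_catC perm_cat2l perm_sym.
have GFb : all unit_block (G ++ F) by rewrite all_cat Gb.
have HGF : {in flatten (G ++ F), forall u, u.2 \in halves M}.
  by move=> u; rewrite -(perm_mem pE); apply: HFU.
have S0 : 0 \in sg (map bval (G ++ F)).
  rewrite map_cat sg_cat; apply/saddP; exists (\sum_(v <- map bval G) v); first exact: sum_sg.
  exists (- \sum_(v <- map bval G) v); last by rewrite subrr.
  apply: (sg_full zM) => //.
    apply: unit_blocks_halves => // u uF; apply: HFU; by rewrite mem_cat uF.
  rewrite -opprD -big_cat /= -map_cat zsubN //.
  rewrite -(subrK (\sum_(u <- flatten (G ++ F)) u.2) (\sum_(v <- _) v)) zsubD ?sum_bval //.
  by rewrite -(perm_big _ pE).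
(* A unit with an element outside the abelian part is a pair; it supplies the [b] and [b'] that
   conjugate the negative part. *)
have [x xGF /hasP[u ux u1]] : exists2 x, x \in G ++ F & has fst x.
  move: hs; rewrite (eq_has_r (perm_mem pE)) => /hasP[u /flattenP[x xGF ux] u1].
  by exists x => //; apply/hasP; exists u.
have [F' pF'] := perm_extract xGF.
have pF : perm_eq (flatten F ++ U) (x ++ flatten F').
  by apply: perm_trans pE _; apply: (perm_flatten pF').
have [xb F'b] : unit_block x /\ all unit_block F'.
  by move: GFb; rewrite (perm_all _ pF') => /andP[].
move: S0; rewrite (perm_sg (perm_map bval pF')) /=.
elim/unit_block_ind: x / xb ux pF {xGF pF'} => [a|b b'] ux pF.
  by move: ux u1; rewrite inE => /eqP->.
rewrite bval2 => /(signed_word F'b)[T [pT T1]]; exists T.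
by split; [apply: perm_trans pF pT|].
Qed.

Lemma size_unit_blocks F : all unit_block F ->
  (size F <= size (flatten F) <= 2 * size F)%N /\
  (~~ has fst (flatten F) -> size (flatten F) = size F).
Proof.
elim: F => [|x F IH] //= /andP[xb /IH[IH1 IH2]].
rewrite size_cat has_cat negb_or.
elim/unit_block_ind: x / xb => [a|b b'] /=; split; slia.
Qed.

(** The process stops because each unit enlarges a set of at most [#|M|] signed sums. [P] is a
    property that the remainder has to keep: trivial in the even case, containing a triple of
    prescribed class sum in the odd case. *)
Lemma greedy_growth (P : seq D -> Prop) M S : zsub M ->
  {in S, forall u, u.2 \in halves M} -> P S ->
  exists F U, [/\ perm_eq S (flatten F ++ U), all unit_block F, P U,
    (size F < #|sg (map bval F)|)%N
    & forall x U', unit_block x -> perm_eq U (x ++ U') -> P U' ->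
        bval x *+ 2 \in stab (sg (map bval F))].
Proof.
move=> zM HS PS.
suff H F U : perm_eq S (flatten F ++ U) -> all unit_block F -> P U ->
    (size F < #|sg (map bval F)|)%N -> exists F U,
    [/\ perm_eq S (flatten F ++ U), all unit_block F, P U,
    (size F < #|sg (map bval F)|)%N
    & forall x U', unit_block x -> perm_eq U (x ++ U') -> P U' ->
        bval x *+ 2 \in stab (sg (map bval F))].
  by apply: (H [::] S) => //=; rewrite sg_nil cards1.
have [k] := ubnP (#|M| - #|sg (map bval F)|)%N; elim: k => // k IH in F U *.
rewrite ltnS => lek pS Fb PU sF.
case: (classic (exists x U', [/\ unit_block x, perm_eq U (x ++ U'), P U'
   & bval x *+ 2 \notin stab (sg (map bval F))])) => [[x [U' [xb pU PU' gx]]]|N].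
  have g := card_sg_grow gx.
  have pS' : perm_eq S (flatten (x :: F) ++ U').
    by rewrite (perm_trans pS) //= -catA perm_sym perm_catCA perm_cat2l perm_sym.
  apply: (IH (x :: F) U') => //=; last by apply: leq_ltn_trans g.
    have : (#|sg (map bval (x :: F))| <= #|M|)%N.
      apply: (card_sg_le zM); apply: unit_blocks_halves => //=; first by rewrite xb.
      by move=> u uF; apply: HS; rewrite (perm_mem pS') mem_cat uF.
    by move: g lek => /= g lek le; move: g lek le; move: #|_| #|_| #|_| => p q r; lia.
  by rewrite xb.
exists F, U; split => // x U' xb pU PU'; apply/negPn/negP => gx.
by apply: N; exists x, U'.
Qed.

Lemma no_growth_compat H U : 0 \in H ->
  (forall x U', unit_block x -> perm_eq U (x ++ U') -> bval x *+ 2 \in H) ->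
  compat H U.
Proof.
move=> H0 HU; split=> [a aU|b b' bU b'U].
  have [U' pU] := perm_extract aU.
  by have := HU [:: (false, a)] U' isT pU; rewrite bval1.
have [->|ne] := eqVneq b b'; first by rewrite subrr mul0rn.
have [U' pU] : exists U', perm_eq U ((true, b) :: (true, b') :: U').
  by apply: perm_extract2; rewrite // xpair_eqE.
by have := HU [:: (true, b); (true, b')] U' isT pU; rewrite bval2.
Qed.

End Growth.

Arguments unit_block {A} x.
Arguments bval {A} x.

(** * Blocks of length [8 #|M|] *)

Lemma zsub_dvd (A : finZmodType) (H M : {set A}) :
  zsub H -> zsub M -> H \subset M -> (#|H| %| #|M|)%N.
Proof.
move=> zH zM HM; pose R (x y : A) := x - y \in H.
have eR : {in M & &, equivalence_rel R}.
  move=> x y z _ _ _; split; first by rewrite /R subrr (proj1 zH).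
  rewrite /R => Hxy; apply/idP/idP => Hz.
    by rewrite -(subrK x y) -addrA zsubD // -opprB zsubN.
  by rewrite -(subrK y x) -addrA zsubD.
have pR := equivalence_partitionP eR.
suff H1 : {in equivalence_partition R M, forall X : {set A}, #|X| = #|H|}.
  by rewrite (card_uniform_partition H1 pR) dvdn_mull.
move=> _ /imsetP[x Mx ->].
rewrite -(card_imset H (inj_comp (addrI x) oppr_inj)); apply: eq_card => y.
rewrite inE; apply/andP/imsetP => [[My Hxy]|[z Hz ->]] /=.
  by exists (x - y); rewrite //= subKr.
by rewrite /R subKr; split=> //; apply: (proj2 zM) => //; apply: (subsetP HM).
Qed.

Lemma dup_extract (T1 T2 : eqType) (f : T1 -> T2) (s : seq T1) :
  ~~ uniq (map f s) -> exists x y s', perm_eq s (x :: y :: s') /\ f x = f y.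
Proof.
elim: s => //= x s IH; rewrite negb_and negbK => /orP[/mapP[y ys fxy]|/IH].
  have [s' ps] := perm_extract ys.
  by exists x, y, s'; rewrite perm_cons.
case=> a [b [s' [ps fab]]]; exists a, b, (x :: s'); split => //.
rewrite (@perm_trans _ (x :: a :: b :: s')) ?perm_cons //.
by rewrite -[_ :: _]/([:: x] ++ [:: a; b] ++ s') perm_catCA.
Qed.

Section DihedralTheorem.

Variable A : finZmodType.
Implicit Types (M H B : {set A}).
Local Notation D := (bool * A)%type.
Implicit Types (S T U R W L Y Z : seq D) (u v : D).

Hypothesis two_torsion : #|[set a : A | a *+ 2 == 0]| = 4%N.
Hypothesis cyclic_doubles : exists g : A, forall a : A, exists i, a *+ 2 = g *+ i.

Definition doubles M := {in M, forall t, exists a, t = a *+ 2}.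

(** The fibres of doubling are cosets of the 2-torsion, which has four elements. *)
Lemma card_halves M : doubles M -> #|halves M| = (4 * #|M|)%N.
Proof.
move=> dM; rewrite -sum1_card (partition_big (fun a => a *+ 2) (mem M)) /=; last first.
  by move=> a; rewrite inE.
rewrite mulnC -sum_nat_const; apply: eq_bigr => t Mt.
have [b tb] := dM t Mt; rewrite sum1_card -two_torsion.
rewrite -[RHS](card_imset _ (addrI b)); apply: eq_card => a.
rewrite unfold_in /= inE; apply/andP/imsetP => [[_ /eqP at_]|[z]].
  exists (a - b); last by rewrite addrCA subrr addr0.
  by rewrite inE mulrnBl at_ tb subrr.
by rewrite inE => /eqP z0 ->; rewrite mulrnDl z0 addr0 -tb.
Qed.

Lemma doubles_sub H M : H \subset M -> doubles M -> doubles H.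
Proof. by move=> HM dM t /(subsetP HM)/dM. Qed.

(* In a cyclic group every quotient has at most one involution. *)
Lemma doubles_involution M H t t' : zsub M -> zsub H -> doubles M ->
  t \in M -> t' \in M -> t *+ 2 \in H -> t' *+ 2 \in H ->
  t \notin H -> t' \notin H -> t - t' \in H.
Proof.
move=> zM zH dM Mt Mt' Ht Ht' Nt Nt'; have [g Hg] := cyclic_doubles.
have [a ta] := dM t Mt; have [i tg] := Hg a; rewrite -ta in tg.
have [a' ta'] := dM t' Mt'; have [j tg'] := Hg a'; rewrite -ta' in tg'.
have i0 : (0 < i)%N by case: i tg Nt => // ->; rewrite mulr0n (proj1 zH).
(* By Bezout [w] is a combination of [t] and [t'], so [w *+ 2] lies in [H]. Both [t] and [t'] are
   multiples of [w], with odd factors as they are outside [H]; hence both are congruent to [w]. *)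
have [k l E _] := egcdnP j i0; pose d := gcdn i j; pose w := g *+ d.
have wE : w = t *+ k - t' *+ l.
  by rewrite tg tg' -!mulrnA mulnC E [(j * l)%N]mulnC mulrnDr addrAC subrr add0r.
have Hw : w *+ 2 \in H.
  by rewrite wE mulrnBl -!mulrnA ![(_ * 2)%N]mulnC !mulrnA (proj2 zH) // zsubMn.
have odd_part s e : s = g *+ (e * d) -> s \notin H -> s - w \in H.
  move=> sE Ns; have se : s = w *+ e by rewrite sE mulnC mulrnA.
  have eE := odd_double_half e; case: (odd e) eE => eE; last first.
    case/negP: Ns; rewrite se -eE add0n -muln2 mulnC mulrnA; exact: zsubMn.
  by rewrite se -eE mulrS addrAC subrr add0r -muln2 mulnC mulrnA zsubMn.
have H1 : t - w \in H.
  by apply: (odd_part t (i %/ d)%N) => //; rewrite divnK ?dvdn_gcdl.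
have H2 : t' - w \in H.
  by apply: (odd_part t' (j %/ d)%N) => //; rewrite divnK ?dvdn_gcdr.
by have := (proj2 zH) _ _ H1 H2; rewrite opprB addrA subrK.
Qed.

Lemma dihprod_abelian T : ~~ has fst T -> dihprod T = (false, \sum_(u <- T) u.2).
Proof.
elim: T => [|[[] a] T IH] //=; first by rewrite big_nil.
by move=> /IH->; rewrite big_cons.
Qed.

Lemma dihprod_elementary T : {in T, forall u, u.2 *+ 2 = 0} ->
  dihprod T = (odd (count fst T), \sum_(u <- T) u.2).
Proof.
elim: T => [|[e a] T IH] HT /=; first by rewrite big_nil.
rewrite IH; last by move=> u uT; apply: HT; rewrite inE uT orbT.
rewrite big_cons /dihmul /= oddD; case: e HT => //= HT; congr (_, a + _).
have : (\sum_(u <- T) u.2) *+ 2 = 0.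
  rewrite -sumrMnl big_seq big1 // => u uT; apply: HT; by rewrite inE uT orbT.
by move/eqP; rewrite mulr2n addr_eq0 => /eqP E; rewrite [in RHS]E.
Qed.

(** * The induction step for a fixed subgroup [M] *)

Section Step.

Variable M : {set A}.
Hypothesis zM : zsub M.
Hypothesis dM : doubles M.
Local Notation m := #|M|.
Local Notation B := (halves M).
Local Notation inB S := {in S, forall u, u.2 \in B}.

Variable c : A -> bool * bool.
Hypothesis cD :
  {in B &, forall a b, c (a + b) = ((c a).1 (+) (c b).1, (c a).2 (+) (c b).2)}.
Hypothesis c0 : {in B, forall a, (c a == (false, false)) = (a \in M)}.

Definition cls u : V := (u.1, c u.2).
Definition csum S : V := vsum (map cls S).

Let zB : zsub B := zsub_halves zM.

Lemma inB_sub S T : {subset T <= S} -> inB S -> inB T.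
Proof. by move=> TS HS u /TS/HS. Qed.

Lemma inB_perm S T : perm_eq S T -> inB S -> inB T.
Proof. by move=> p HS u; rewrite -(perm_mem p); apply: HS. Qed.

Lemma inB_cat S T : inB (S ++ T) -> inB S /\ inB T.
Proof. by move=> H; split=> u uS; apply: H; rewrite mem_cat uS ?orbT. Qed.

Lemma csum_perm S T : perm_eq S T -> csum S = csum T.
Proof. by move=> p; apply: perm_vsum; apply: perm_map. Qed.

Lemma csum_cat S T : csum (S ++ T) = vadd (csum S) (csum T).
Proof. by rewrite /csum map_cat vsum_cat. Qed.

Lemma csum_cons u S : csum (u :: S) = vadd (cls u) (csum S).
Proof. by []. Qed.

Lemma csumE S : inB S -> csum S = (odd (count fst S), c (\sum_(u <- S) u.2)).
Proof.
elim: S => [|u S IH] HS.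
  rewrite big_nil /csum /=; congr (_, _); apply/esym/eqP.
  by rewrite c0 ?inE ?mul0rn (proj1 zM).
have HS' : inB S by move=> v vS; apply: HS; rewrite inE vS orbT.
rewrite csum_cons IH // big_cons cD /vadd /=; first by rewrite oddD; case: u.1.
  by apply: HS; rewrite mem_head.
have /allP : all (mem B) (map snd S) by apply/allP => _ /mapP[v vS ->]; apply: HS'.
by move=> /allP/(zsub_sum zB); rewrite big_map.
Qed.

Lemma csum0 S : inB S -> csum S = v0 ->
  ~~ odd (count fst S) /\ \sum_(u <- S) u.2 \in M.
Proof.
move=> HS; rewrite csumE // => -[-> cS]; split => //.
rewrite -c0 ?cS //.
have /allP : all (mem B) (map snd S) by apply/allP => _ /mapP[v vS ->]; apply: HS.
by move=> /allP/(zsub_sum zB); rewrite big_map.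
Qed.

Lemma cls_eq u v : u.2 \in B -> v.2 \in B -> cls u = cls v ->
  u.1 = v.1 /\ u.2 - v.2 \in M.
Proof.
move=> Bu Bv [-> cE]; split => //; have Bd : u.2 - v.2 \in B by apply: (proj2 zB).
rewrite -c0 //; have := cD Bd Bv; rewrite subrK cE.
by case: (c v.2) (c (u.2 - v.2)) => [[] []] [[] []].
Qed.

Lemma pair_value H u v : zsub H -> u.1 = v.1 -> u.2 - v.2 \in H ->
  (~~ u.1 -> u.2 *+ 2 \in H) ->
  exists2 a, a \in H & dihprod [:: u; v] = (false, a).
Proof.
case: u v => [e a] [_ b] zH /= <- Hab Ha; rewrite /dihmul /= addbF addbb.
case: e Ha => Ha; first by exists (a - b); rewrite // subr0.
exists (a + b); last by rewrite addr0.
have -> : a + b = a *+ 2 - (a - b) by rewrite opprB mulr2n addrA addrAC addrK.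
by apply: (proj2 zH) => //; apply: Ha.
Qed.

Lemma cls_pair_value u v : u.2 \in B -> v.2 \in B -> cls u = cls v ->
  exists2 a, a \in M & dihprod [:: u; v] = (false, a).
Proof.
move=> Bu Bv /(cls_eq Bu Bv)[E1 E2]; apply: pair_value => // _.
by move: Bu; rewrite inE.
Qed.

Local Notation flat ps := (flatten [seq [:: p.1; p.2] | p <- ps]).

Lemma csum_pairs (ps : seq (D * D)) :
  (forall p, p \in ps -> cls p.1 = cls p.2) -> csum (flat ps) = v0.
Proof.
elim: ps => // p ps IH Hp; rewrite csum_cat IH; last first.
  by move=> q qps; apply: Hp; rewrite inE qps orbT.
by rewrite /csum /= (Hp p (mem_head _ _)) vaddA vaddvv.
Qed.

Lemma size_flat (ps : seq (D * D)) : size (flat ps) = (2 * size ps)%N.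
Proof. by elim: ps => //= p ps ->; slia. Qed.

Lemma class_split S : exists (ps : seq (D * D)) L, [/\ perm_eq S (flat ps ++ L),
  forall p, p \in ps -> cls p.1 = cls p.2 & uniq (map cls L)].
Proof.
have [k] := ubnP (size S); elim: k => // k IH in S *; rewrite ltnS => sS.
have [uS|/dup_extract[x [y [S' [pS cxy]]]]] := boolP (uniq (map cls S)).
  by exists [::], S.
have [|ps [L [pS' Hps uL]]] := IH S'; first by move: sS; rewrite (perm_size pS); slia.
exists ((x, y) :: ps), L; split => //.
  by rewrite (perm_trans pS) //= !perm_cons.
by move=> p; rewrite inE => /orP[/eqP->|/Hps].
Qed.

Lemma remove_pairs k W : (2 * k + 7 <= size W)%N ->
  exists R W', [/\ perm_eq W (R ++ W'), size R = (2 * k)%N & csum R = v0].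
Proof.
move=> sW; have [||ps [W' [sps pW Hps]]] := @perm_pairs _ (fun u v => cls u == cls v) 8 k W.
- move=> t _ st; have : ~~ uniq (map cls t).
    by apply: contraL st => /uniqV_size; rewrite size_map -leqNgt.
  by case/dup_extract => x [y [t' [pt E]]]; exists x, y, t'; rewrite E.
- by slia.
exists (flat ps), W'; rewrite size_flat sps csum_pairs //.
by move=> p /Hps/eqP.
Qed.

Lemma abelian_classes L : ~~ has fst L -> uniq (map cls L) -> (size L <= 4)%N.
Proof.
move=> nL uL; rewrite -(size_map cls).
apply: (uniq_leq_size uL (s2 := [seq v <- enumV | ~~ v.1])) => _ /mapP[u uL' ->].
by rewrite mem_filter mem_enumV andbT; apply: contra nL => u1; apply/hasP; exists u.
Qed.

Lemma zero_sum_blocks (Ws : seq (seq D)) : (m <= size Ws)%N ->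
  (forall w, w \in Ws -> \sum_(u <- w) u.2 \in M /\ w != [::]) ->
  exists U R, [/\ perm_eq (flatten Ws) (U ++ R), (0 < size U)%N & \sum_(u <- U) u.2 = 0].
Proof.
move=> sW HW; pose f (w : seq D) : A := \sum_(u <- w) u.2.
have [||U [R [pU U0 sU]]] := davenport_card zM (T := map f Ws).
- by apply/allP => _ /mapP[w /HW[Mw _] ->].
- by rewrite size_map.
have [W1 [W2 [pW E _]]] := perm_map_split pU.
exists (flatten W1), (flatten W2); split.
- by rewrite -flatten_cat perm_flatten.
- case: W1 pW E => [|w W1] pW E; first by rewrite E in U0.
  have [|_] := HW w; first by rewrite (perm_mem pW) mem_head.
  by rewrite /= size_cat -size_eq0; slia.
rewrite big_flatten -[RHS]sU E big_map.
by [].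
Qed.

(** Of [2 m + 1] elements, pairs of equal class have sums in [M], and one or three elements are left
    over. One leaves [m] pairs; three leave [m - 1], and supply one more block with sum in [M]. Then
    [m] such blocks contain a zero sum. *)
Lemma davenport_halves : davenport_le B (2 * m + 1).
Proof.
move=> T BT sT; pose S := map (pair false) (take (2 * m + 1) T).
have sS : size S = (2 * m + 1)%N by rewrite size_map size_takel.
have nS : ~~ has fst S by rewrite has_map has_pred0.
have BS : inB S by move=> _ /mapP[x /mem_take/(allP BT) Bx ->].
suff [U [R [pU U0 sU]]] : exists U R,
    [/\ perm_eq S (U ++ R), (0 < size U)%N & \sum_(u <- U) u.2 = 0].
  exists (map snd U), (map snd R ++ drop (2 * m + 1) T); split.
  - rewrite -{1}(cat_take_drop (2 * m + 1) T) catA perm_cat2r -map_cat.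
    by rewrite -(permPr (perm_map snd pU)) -map_comp map_id.
  - by rewrite size_map.
  by rewrite big_map.
have [ps [L [pS Hps uL]]] := class_split S.
have [Bps BL] := inB_cat (inB_perm pS BS).
have nL : ~~ has fst L.
  by move: nS; rewrite (eq_has_r (perm_mem pS)) has_cat negb_or => /andP[].
have sL := abelian_classes nL uL.
have sps : (2 * m + 1 = 2 * size ps + size L)%N.
  by rewrite -sS (perm_size pS) size_cat size_flat.
pose P := [seq [:: p.1; p.2] | p <- ps].
have HP w : w \in P -> \sum_(u <- w) u.2 \in M /\ w != [::].
  case/mapP=> p pps ->; split=> //; have fp : {subset [:: p.1; p.2] <= flat ps}.
    by move=> u up; apply/flattenP; exists [:: p.1; p.2] => //; apply: map_f.
  have [B1 B2] : p.1.2 \in B /\ p.2.2 \in B.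
    by split; apply: Bps; apply: fp; rewrite !inE eqxx ?orbT.
  have [a Ma] := cls_pair_value B1 B2 (Hps p pps).
  rewrite dihprod_abelian; first by case=> ->.
  apply/negP => /hasP[u /fp uf u1]; case/negP: nS; apply/hasP; exists u => //.
  by rewrite (perm_mem pS) mem_cat uf.
have finish Ws L' : perm_eq S (flatten Ws ++ L') -> (m <= size Ws)%N ->
    (forall w, w \in Ws -> \sum_(u <- w) u.2 \in M /\ w != [::]) -> exists U R,
    [/\ perm_eq S (U ++ R), (0 < size U)%N & \sum_(u <- U) u.2 = 0].
  move=> pW sW /(zero_sum_blocks sW)[U [R [pU U0 sU]]].
  exists U, (R ++ L'); split => //; apply: perm_trans pW _.
  by rewrite catA perm_cat2r.
have sPs : size P = size ps by rewrite size_map.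
have [sL1|sL3] : size L = 1%N \/ size L = 3%N by slia.
  by apply: finish pS _ HP; rewrite sPs; move: sps; rewrite sL1; slia.
have HPw w : \sum_(u <- w) u.2 \in M -> w != [::] ->
    forall w', w' \in w :: P -> \sum_(u <- w') u.2 \in M /\ w' != [::].
  by move=> Mw w0 w'; rewrite inE => /orP[/eqP->|/HP].
have /orP[/mapP[l lL /esym]|/eqP sL0] : (v0 \in map cls L) || (vsum (map cls L) == v0).
- by apply: uniqV_triangle; rewrite ?size_map // has_map.
- case=> _ cl0; have [L' pL] := perm_extract lL.
  apply: (finish ([:: l] :: P) L'); [|slia|].
    rewrite (perm_trans pS) // perm_sym -[flatten _]/([:: l] ++ flat ps) -catA perm_catCA.
    by rewrite perm_cat2l perm_sym.
  by apply: HPw; rewrite // big_seq1 -c0 ?cl0 //; apply: BL.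
apply: (finish (L :: P) [::]); [|slia|].
  by rewrite cats0 (perm_trans pS) //= perm_catC.
by apply: HPw; [have [] := csum0 BL sL0|case: (L) sL3].
Qed.

Lemma take_perm k S : (k <= size S)%N ->
  exists S1 S2, perm_eq S (S1 ++ S2) /\ size S1 = k.
Proof.
by move=> kS; exists (take k S), (drop k S); rewrite cat_take_drop size_takel.
Qed.

Lemma has_block_sub k S S1 S2 : perm_eq S (S1 ++ S2) -> has_block k S1 -> has_block k S.
Proof. by move=> p H; apply: has_block_perm p _; apply: has_block_catl. Qed.

(* Over a trivial [M] the group is elementary abelian of order 8. *)
Lemma base_case S : m = 1%N -> inB S -> (11 <= size S)%N -> has_block 8 S.
Proof.
move=> m1 + /take_perm[S1 [S2 [pS sS]]] => /(inB_perm pS)/inB_cat[HS _].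
apply: (has_block_sub pS) => {S pS S2}.
have M0 x : x \in M -> x = 0.
  have /eqP/cards1P[z Mz] := m1; have := proj1 zM.
  by rewrite Mz => /set1P<- /set1P.
have good T R : perm_eq S1 (T ++ R) -> size T = 8%N -> csum T = v0 -> has_block 8 S1.
  move=> pT sT T0; exists T, R; split=> //.
  have [HT _] := inB_cat (inB_perm pT HS); have [ev /M0 s0] := csum0 HT T0.
  rewrite dihprod_elementary ?(negPf ev) ?s0 // => u uT.
  by apply: M0; have := HT u uT; rewrite inE.
have [ps [L [pL Hps uL]]] := class_split S1.
have sps : (11 = 2 * size ps + size L)%N by rewrite -sS (perm_size pL) size_cat size_flat.
have sL8 := uniqV_size uL; rewrite size_map in sL8.
have split_ps k : (k <= size ps)%N -> exists R,
    perm_eq (flat ps) (flat (take k ps) ++ R) /\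
    csum (flat (take k ps)) = v0 /\ size (flat (take k ps)) = (2 * k)%N.
  move=> kps; exists (flat (drop k ps)); split.
    by rewrite -flatten_cat -map_cat cat_take_drop.
  rewrite size_flat size_takel // csum_pairs // => p /mem_take; exact: Hps.
have [leL|gtL] := leqP (size L) 3.
  have [|R [pR [c4 s4]]] := split_ps 4%N; first by slia.
  apply: (good (flat (take 4 ps)) (R ++ L)) => //.
  by rewrite (perm_trans pL) // catA perm_cat2r.
(* The length 11 is odd, so [L] has 5 or 7 elements and at least two pairs remain; these and an
   affine plane in [L] make 8. *)
have gt4 : (4 < size (map cls L))%N by rewrite size_map; slia.
have [q /andP[/eqP sq /eqP q0] Hq] := subV_seq (uniqV_plane uL gt4).
have [t /perm_map_split[L1 [L2 [pL12 qE _]]]] := Hq _ (perm_refl _).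
have [|R [pR [c4 s4]]] := split_ps 2%N; first by slia.
apply: (good (flat (take 2 ps) ++ L1) (R ++ L2)).
- rewrite (perm_trans pL) // (perm_trans (perm_cat pR pL12)) //.
  by rewrite -!catA perm_cat2l perm_catCA.
- by rewrite size_cat s4 -(size_map cls L1) -qE sq.
by rewrite csum_cat c4 /csum -qE q0.
Qed.

Hypothesis m_gt1 : (1 < m)%N.

Hypothesis IH : forall H, zsub H -> H \subset M -> (#|H| < m)%N ->
  forall S, compat H S -> (10 * #|H| + 1 <= size S)%N -> has_block (8 * #|H|) S.

(** With [#|M| = q * #|H|], [q] blocks of length [8 * #|H|] are extracted; only the last one needs
    the surplus [2 * #|H| + 1]. *)
Lemma smaller_subgroup H S : zsub H -> H \subset M -> (#|H| < m)%N -> compat H S ->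
  (8 * m + 2 * #|H| + 1 <= size S)%N -> has_block (8 * m) S.
Proof.
move=> zH HM Hm cS sS; have /dvdnP[q mE] := zsub_dvd zH zM HM.
have -> : (8 * m = q * (8 * #|H|))%N by rewrite mE; slia.
apply: (has_block_mul (c := (10 * #|H| + 1)%N) _ cS); last first.
  by move: sS; rewrite mE; slia.
by move=> T cT sT; apply: (IH zH HM Hm).
Qed.

Lemma full_case F U k : all unit_block F -> inB (flatten F ++ U) ->
  (m <= #|sg (map bval F)|)%N -> csum (flatten F ++ U) = v0 ->
  has fst (flatten F ++ U) -> size (flatten F ++ U) = (8 * m + 2 * k)%N ->
  (2 * k + 8 <= size U)%N -> has_block (8 * m) (flatten F ++ U).
Proof.
move=> Fb HFU full sFU hs szFU szU.
(* If [F] has no element outside the abelian part, one is reserved in [W0] so that it is not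
   discarded. This accounts for [8] in the hypothesis against [7] in [remove_pairs]. *)
have [W0 [W [pU hs' sW]]] : exists W0 W, [/\ perm_eq U (W0 ++ W),
    has fst (flatten F ++ W0) & (2 * k + 7 <= size W)%N].
  have [hF|nF] := boolP (has fst (flatten F)).
    by exists [::], U; rewrite cats0; split=> //; slia.
  move: hs; rewrite has_cat (negPf nF) /= => /hasP[o oU o1].
  have [W pU] := perm_extract oU; exists [:: o], W; rewrite has_cat /= o1 orbT; split=> //.
  by move: szU; rewrite (perm_size pU) /=; slia.
have [R [W' [pW sR cR]]] := remove_pairs sW.
have pFU : perm_eq (flatten F ++ U) ((flatten F ++ (W0 ++ W')) ++ R).
  rewrite -!catA perm_cat2l (perm_trans pU) // perm_cat2l (perm_trans pW) //.
  by rewrite perm_catC.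
apply: (has_block_sub pFU).
have [HT _] := inB_cat (inB_perm pFU HFU).
have cT : csum (flatten F ++ (W0 ++ W')) = v0.
  by move: sFU; rewrite (csum_perm pFU) csum_cat cR vaddC vadd0.
have [ev sM] := csum0 HT cT.
have [|T [pT T1]] := full_word zM Fb HT full ev _ sM.
  by rewrite catA has_cat hs'.
exists T, [::]; rewrite cats0; split=> //.
rewrite -(perm_size pT); have := perm_size pFU; rewrite szFU size_cat sR.
by move=> ?; apply/eqP; rewrite -(eqn_add2r (2 * k)); apply/eqP.
Qed.

(** Fewer units than signed sums and a missed coset of the stabilizer leave at most
    [m - #|stab X| - 1] units, each of length at most two. *)
Lemma not_full F : all unit_block F -> inB (flatten F) ->
  let X := sg (map bval F) in (size F < #|X|)%N -> (#|X| < m)%N ->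
  [/\ zsub (stab X), stab X \subset M, (#|stab X| < m)%N
    & (size (flatten F) + 2 * #|stab X| + 2 <= 2 * m)%N].
Proof.
move=> Fb HF X sF sX; have HX := unit_blocks_halves zM Fb HF.
have le : (#|X| + #|stab X| <= m)%N := sg_not_full zM HX sX.
have [/andP[_ sz] _] := size_unit_blocks Fb.
split; [exact: zsub_stab|exact: stab_sg_sub| |].
  by move: le sF; rewrite -/X; move: #|X| #|stab X| m (size F) => a b d e; clear; lia.
move: le sF sz; rewrite -/X; move: #|X| #|stab X| m (size F) (size _) => a b d e f; clear; lia.
Qed.

Lemma even_case S : inB S -> size S = (10 * m)%N -> csum S = v0 -> has_block (8 * m) S.
Proof.
move=> HS sS S0; have [hs|ns] := boolP (has fst S); last first.
  (* Here [#|B| = 4 m]: two blocks of length [#|B|] are wanted, and [2 * (4 m) + (2 m + 1)] is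
     exactly one more than the length [10 m]. *)
  have [|||U [R [pU sU U0]]] :=
    gao_multiple (T := map snd S) (d := (2 * m + 1)%N) (j := 2) zB davenport_halves.
  - by rewrite addn1.
  - by apply/allP => _ /mapP[u uS ->]; apply: HS.
  - by rewrite size_map sS card_halves //; slia.
  have [S1 [S2 [pS UE _]]] := perm_map_split pU.
  exists S1, S2; split=> //; first by rewrite -(size_map snd) -UE sU card_halves //; slia.
  rewrite dihprod_abelian; first by rewrite -[in RHS]U0 UE big_map.
  by move: ns; rewrite (eq_has_r (perm_mem pS)) has_cat negb_or => /andP[].
have [F [U [pS Fb _ sF HU]]] := greedy_growth (P := fun=> True) zM HS I.
have HFU := inB_perm pS HS; have [HF HU'] := inB_cat HFU.
have [/andP[_ szF] _] := size_unit_blocks Fb.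
have sFU : (size (flatten F) + size U = 10 * m)%N by rewrite -sS (perm_size pS) size_cat.
have [full|nfull] := leqP m #|sg (map bval F)|.
  have le := card_sg_le zM (unit_blocks_halves zM Fb HF).
  apply: (has_block_perm pS); apply: (full_case (k := m)) => //.
  - by rewrite -(csum_perm pS).
  - by rewrite -(eq_has_r (perm_mem pS)).
  - by rewrite size_cat sFU; slia.
  move: m_gt1 sF le szF sFU; move: #|sg _| m (size F) (size _) (size _) => a b d e f; clear; lia.
have [zH HM Hm sz] := not_full Fb HF sF nfull.
apply: (has_block_perm pS); apply: has_block_catr.
apply: (smaller_subgroup zH HM Hm).
  apply: no_growth_compat; first exact: (proj1 zH).
  by move=> x U' xb pU; apply: HU xb pU _.
move: sz sFU; move: #|stab _| m (size _) (size _) => a b d e; clear; lia.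
Qed.

(** Discarding [Y] makes the class sum zero and leaves [8 m + 2 (m - 1)] elements; the even surplus
    goes in pairs of equal class. *)
Lemma odd_of_line S Y F U : inB S -> size S = (10 * m + 1)%N ->
  perm_eq S (flatten F ++ Y ++ U) -> size Y = 3%N -> csum Y = csum S ->
  all unit_block F -> (size F < m)%N -> (m <= #|sg (map bval F)|)%N ->
  has fst (flatten F ++ U) -> has_block (8 * m) S.
Proof.
move=> HS sS pS sY cY Fb sF full hs.
have pS' : perm_eq S ((flatten F ++ U) ++ Y).
  by rewrite (perm_trans pS) // -catA perm_cat2l perm_catC.
apply: (has_block_sub pS'); have [HFU _] := inB_cat (inB_perm pS' HS).
have [/andP[_ szF] _] := size_unit_blocks Fb.
have sz : size (flatten F ++ U) = (8 * m + 2 * m.-1)%N.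
  have : (10 * m + 1 = size (flatten F ++ U) + 3)%N.
    by rewrite -sS -sY -size_cat; apply: perm_size.
  by move: m_gt1; move: m (size _) => a b; clear; lia.
apply: (full_case (k := m.-1)) => //.
  have := csum_perm pS'; rewrite csum_cat cY -[csum S in LHS]vadd0.
  by rewrite !(vaddC _ (csum S)) => /vaddI.
move: sz; rewrite size_cat; move: m_gt1 sF szF.
by move: m (size F) (size _) (size _) => a b d e; clear; lia.
Qed.

(** Differences lie in [M] and their doubles in [H], so by cyclicity the elements meet at most two
    cosets of [H]: among any three, two form a pair with product in [H]. This requires two elements
    fewer than [smaller_subgroup]. *)
Lemma single_class_case H S : zsub H -> H \subset M -> compat H S -> inB S ->
  {in S &, forall u v, cls u = cls v} ->
  (8 * m + 2 * #|H| <= size S + 1)%N -> has_block (8 * m) S.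
Proof.
move=> zH HM cS HS sc sS; have H0 := zsub_gt0 zH.
pose r u v := (u.1 == v.1) && (u.2 - v.2 \in H).
have rP u v : u \in S -> v \in S -> [/\ u.1 = v.1, u.2 - v.2 \in M & (u.2 - v.2) *+ 2 \in H].
  move=> uS vS; have [E1 E2] := cls_eq (HS u uS) (HS v vS) (sc u v uS vS).
  split=> //; case: cS => cS1 cS2; case: u v E1 uS vS {E2} => [[] a] [_ b] /= <-.
    exact: cS2.
  by move=> /cS1 Ha /cS1 Hb; rewrite mulrnBl (proj2 zH).
have [||ps [L [sps pL Hps]]] := @perm_pairs _ r 2 (4 * m + #|H| - 1)%N S.
- move=> t tS; case: t tS => [|x [|y [|z t]]] // tS _.
  have [xS yS zS] : [/\ x \in S, y \in S & z \in S].
    by split; apply: tS; rewrite !inE eqxx ?orbT.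
  have [xy1 xyM xyH] := rP x y xS yS; have [xz1 xzM xzH] := rP x z xS zS.
  have [xy|nxy] := boolP (x.2 - y.2 \in H).
    by exists x, y, (z :: t); rewrite /r xy1 eqxx.
  have [xz|nxz] := boolP (x.2 - z.2 \in H).
    exists x, z, (y :: t); rewrite /r xz1 eqxx; split=> //.
    by rewrite perm_cons (perm_catCA [:: y] [:: z]).
  exists z, y, (x :: t); rewrite /r -xz1 xy1 eqxx; split.
    by perm_count.
  have := doubles_involution zM zH dM xyM xzM xyH xzH nxy nxz.
  by rewrite opprB addrC addrA subrK.
- by move: sS H0; move: m #|H| (size S) => a b d; clear; lia.
have /dvdnP[q mE] := zsub_dvd zH zM HM.
apply: (has_block_perm pL); have -> : (8 * m = 2 * ((4 * q) * #|H|))%N by rewrite mE; slia.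
apply: has_block_pairs => // [p pps|]; last by rewrite sps mE; move: H0; move: #|H| => a; nia.
have /andP[/eqP E1 E2] := Hps p pps.
have p1S : p.1 \in S.
  rewrite (perm_mem pL) mem_cat; apply/orP; left; apply/flattenP.
  by exists [:: p.1; p.2]; rewrite ?mem_head // map_f.
apply: pair_value => // np; apply: (proj1 cS); move: p1S np.
by case: (p.1) => [[] a].
Qed.

Lemma compat_cons_ins H S a : compat H S -> a *+ 2 \in H -> compat H ((false, a) :: S).
Proof.
move=> [c1 c2] Ha; split=> [b|b b']; rewrite !inE.
  by case/orP=> [/eqP[->]|/c1].
by move=> /= bS b'S; apply: c2.
Qed.

Lemma compat_cons_out H S b : zsub H -> compat H S ->
  (forall b', (true, b') \in S -> (b - b') *+ 2 \in H) -> compat H ((true, b) :: S).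
Proof.
move=> zH [c1 c2] Hb; split=> [a|b1 b2]; rewrite !inE; first exact: c1.
case/orP=> [/eqP[->]|b1S]; case/orP=> [/eqP[->]|b2S].
- by rewrite subrr mul0rn (proj1 zH).
- exact: Hb.
- by rewrite -opprB mulNrn zsubN // Hb.
exact: c2.
Qed.

(* A line is a triple whose classes sum to the class sum [w] of the whole sequence:
   leaving it out makes the other classes sum to zero. *)
Lemma exchange_line Y x1 x2 w : size Y = 3%N -> csum Y = w ->
  (forall u, u \in [:: x1, x2 & Y] -> cls u != w) -> cls x1 != cls x2 ->
  exists y Z R, [/\ perm_eq (Y ++ [:: x1; x2]) (y :: Z ++ R), y \in Y,
    size Z = 3%N & csum Z = w].
Proof.
case: Y => [|y1 [|y2 [|y3 []]]] // _ wE Hw ne.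
pose good a := cls x1 = cls a \/ cls x2 = cls a \/
  vadd w (vadd (cls x1) (cls x2)) = cls a.
have pE a b d : perm_eq [:: y1; y2; y3] [:: a; b; d] -> good a ->
    exists y Z R, [/\ perm_eq ([:: y1; y2; y3] ++ [:: x1; x2]) (y :: Z ++ R),
      y \in [:: y1; y2; y3], size Z = 3%N & csum Z = w].
  move=> pY Ha; have wa : csum [:: a; b; d] = w by rewrite -(csum_perm pY).
  have E R : perm_eq ([:: a; b; d] ++ [:: x1; x2]) R ->
      perm_eq ([:: y1; y2; y3] ++ [:: x1; x2]) R.
    by apply: perm_trans; rewrite perm_cat2r.
  case: Ha => [Ha|[Ha|Ha]].
  - exists a, [:: x1; b; d], [:: x2]; split=> //.
    + by apply: E; rewrite /= perm_cons (perm_catCA [:: b; d] [:: x1] [:: x2]).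
    + by rewrite (perm_mem pY) mem_head.
    + by rewrite -wa /csum /= Ha.
  - exists a, [:: x2; b; d], [:: x1]; split=> //.
    + apply: E; rewrite /= perm_cons (perm_catC [:: b; d]) /=.
      by rewrite (perm_catCA [:: x1] [:: x2] [:: b; d]) /= perm_cons (perm_catC [:: x1]).
    + by rewrite (perm_mem pY) mem_head.
    + by rewrite -wa /csum /= Ha.
  exists b, [:: x1; x2; a], [:: d]; split=> //.
  + apply: E; rewrite (perm_catCA [:: a] [:: b] [:: d; x1; x2]) /= perm_cons.
    by rewrite (perm_catC [:: a; d]) /= !perm_cons.
  + by rewrite (perm_mem pY) !inE eqxx orbT.
  rewrite /csum /= -Ha (vaddC _ v0) vadd0 !vaddA (vaddC _ w) -!vaddA.
  by rewrite (vaddA (cls x2)) (vaddC (cls x2)) -!vaddA vaddvv (vaddC _ v0) vadd0 vaddvv vaddC vadd0.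
have p2 : perm_eq [:: y1; y2; y3] [:: y2; y1; y3] by rewrite (perm_catCA [:: y1] [:: y2]).
have p3 : perm_eq [:: y1; y2; y3] [:: y3; y1; y2] by rewrite (perm_catC [:: y1; y2]).
have wN : w \notin [:: cls y1; cls y2; cls y3; cls x1; cls x2].
  rewrite !inE !negb_or ![w == _]eq_sym !Hw //; by rewrite !inE eqxx ?orbT.
have F := @fano (cls y1) (cls y2) (cls y3) (cls x1) (cls x2).
have {}F : [|| cls x1 \in [:: cls y1; cls y2; cls y3],
               cls x2 \in [:: cls y1; cls y2; cls y3]
             | vadd w (vadd (cls x1) (cls x2)) \in [:: cls y1; cls y2; cls y3]].
  by move: F; rewrite -[vsum _]/(csum [:: y1; y2; y3]) wE; apply.
have p1 := perm_refl [:: y1; y2; y3].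
suff [a [b [d [p Ga]]]] : exists a b d, perm_eq [:: y1; y2; y3] [:: a; b; d] /\ good a.
  exact: pE p Ga.
by case/or3P: F; rewrite !inE => /or3P[]/eqP Ha; rewrite /good;
  solve [exists y1, y2, y3; auto|exists y2, y1, y3; auto|exists y3, y1, y2; auto].
Qed.

(* Two elements of [U] of distinct classes would span with [Y] a second line, which
   frees a point of [Y] for further growth. *)
Lemma nearly_single_class H Y U w : zsub H -> size Y = 3%N -> csum Y = w ->
  {in Y ++ U, forall u, cls u != w} -> (2 < size U)%N -> compat H U ->
  {in Y, forall y, ~ compat H (y :: U)} ->
  (forall x U', unit_block x -> perm_eq (Y ++ U) (x ++ U') ->
     (exists Z R, [/\ perm_eq U' (Z ++ R), size Z = 3%N & csum Z = w]) ->
     bval x *+ 2 \in H) ->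
  exists S R, [/\ perm_eq U (S ++ R), (size R <= 1)%N
                 & {in S &, forall u v, cls u = cls v}].
Proof.
move=> zH sY cY Hw sU cU ncU grow.
(* The exchange frees some [y] of [Y] that is incompatible with [U]. It lies outside the abelian
   part, since otherwise it could have been used for growth. An outside element in [U1] would form
   with [y] a unit and make [y] compatible; so would, vacuously, the absence of outside elements in
   [U]. *)
have key x1 x2 U1 : perm_eq U (x1 :: x2 :: U1) -> cls x1 != cls x2 ->
    ~~ has fst U1 /\ x1.1 || x2.1.
  move=> pU ne; have [|y [Z [R [pZ yY sZ cZ]]]] := exchange_line sY cY _ ne.
    move=> u; rewrite !inE => /or3P[/eqP->|/eqP->|uY]; apply: Hw; rewrite mem_cat ?uY //.
      by rewrite (perm_mem pU) mem_head orbT.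
    by rewrite (perm_mem pU) !inE eqxx !orbT.
  have pYU : perm_eq (Y ++ U) (y :: Z ++ (R ++ U1)).
    apply: (@perm_trans _ (Y ++ [:: x1, x2 & U1])); first by rewrite perm_cat2l.
    by rewrite -(perm_cat2r U1) -catA /= -catA in pZ.
  have incompat := ncU y yY.
  have y1 : y.1.
    case: y incompat pYU {pZ yY} => [[] a] // N pYU; case: N.
    apply: compat_cons_ins => //; rewrite -(bval1 a).
    by apply: (grow [:: (false, a)] _ isT pYU); exists Z, (R ++ U1).
  have h1 : ~~ has fst U1.
    apply/negP => /hasP[[[] o] // oU _]; case: y y1 incompat pYU {pZ yY} => [[] b] // _ N pYU.
    case: N; apply: compat_cons_out => // b' b'U.
    have [U2 pU1] := perm_extract oU.
    have Ho : (b - o) *+ 2 \in H.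
      rewrite -bval2; apply: (grow [:: (true, b); (true, o)] (Z ++ R ++ U2)) => //;
        last by exists Z, (R ++ U2).
      apply: perm_trans pYU _; rewrite /= perm_cons.
      rewrite !catA (perm_trans (_ : perm_eq _ ((Z ++ R) ++ (true, o) :: U2))) ?perm_cat2l //.
      by rewrite -cat1s perm_catCA.
    have oU' : (true, o) \in U by rewrite (perm_mem pU) !inE oU !orbT.
    have := proj2 cU _ _ oU' b'U => Ho'.
    by rewrite -(subrK o b) -addrA mulrnDl zsubD.
  split=> //; apply/negPn/negP; rewrite negb_or => /andP[n1 n2].
  case: y y1 incompat {pYU pZ yY} => [[] b] // _; apply.
  apply: compat_cons_out => // b'; rewrite (perm_mem pU) !inE => /or3P[/eqP E|/eqP E|b'U].
  - by rewrite -E in n1.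
  - by rewrite -E in n2.
  by case/hasP: h1; exists (true, b').
have [/allP alleq|] := boolP (all (fun u => all (fun v => cls u == cls v) U) U).
  exists U, [::]; rewrite cats0; split=> // u v uU vU.
  by apply/eqP; have /allP := alleq u uU; apply.
move=> /allPn[a aU /allPn[b bU nab]].
have [U1 pU] : exists U1, perm_eq U (a :: b :: U1).
  by apply: perm_extract2 => //; apply: contra nab => /eqP->.
wlog a1 : a b aU bU nab pU / a.1.
  move=> W; have [_ /orP[a1|b1]] := key _ _ _ pU nab; first exact: (W a b).
  apply: (W b a) => //; first by rewrite eq_sym.
  by rewrite (perm_trans pU) // (perm_catCA [:: a] [:: b]).
have [nU1 _] := key _ _ _ pU nab.
have cne u v : u.1 -> ~~ v.1 -> cls u != cls v.
  by move=> u1; apply: contra => /eqP E; have := congr1 fst E => /= <-.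
(* A third element [z] is abelian, so [a] and [z] have distinct classes and [key] applies to them,
   with [b] among the others. *)
have b1 : ~~ b.1.
  case: U1 pU nU1 => [pU _|z U1 pU]; first by move: sU; rewrite (perm_size pU).
  rewrite /= negb_or => /andP[z1 _].
  have pU' : perm_eq U (a :: z :: b :: U1).
    by rewrite (perm_trans pU) // perm_cons (perm_catCA [:: b] [:: z]).
  by have [] := key _ _ _ pU' (cne _ _ a1 z1); rewrite /= negb_or => /andP[].
exists (b :: U1), [:: a]; split=> //; first by rewrite (perm_trans pU) // -cat1s perm_catC.
(* Two distinct classes here would leave [a] among the others, which [key] forbids for an outside
   element. *)
have same u v : u \in b :: U1 -> v \in b :: U1 -> u != v -> cls u = cls v.
  move=> uS vS nuv; have [U2 pS] := perm_extract2 uS vS nuv.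
  apply/eqP/negPn/negP => ncl.
  have pU' : perm_eq U (u :: v :: (a :: U2)).
    rewrite (perm_trans pU) // -cat1s (perm_trans (_ : perm_eq _ ([:: a] ++ [:: u, v & U2]))) ?perm_cat2l //.
    by rewrite (perm_catCA [:: a] [:: u; v]).
  by have [] := key _ _ _ pU' ncl; rewrite /= a1.
by move=> u v uS vS; have [->//|/same] := eqVneq u v; apply.
Qed.

Lemma odd_case S : inB S -> size S = (10 * m + 1)%N -> has_block (8 * m) S.
Proof.
move=> HS sS; set w := csum S; have [/hasP[l lS /eqP lw]|/hasPn Hw] := boolP (has (fun u => cls u == w) S).
  have [S' pS] := perm_extract lS.
  have HS' : inB S' by have [_] := inB_cat (inB_perm pS HS : inB ([:: l] ++ S')).
  apply: (has_block_perm pS); apply: (@has_block_catr _ _ S' [:: l]).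
  apply: even_case => //.
    by have := perm_size pS; rewrite sS /= addn1 => -[].
  have := csum_perm pS; rewrite csum_cons -/w -lw -{1}[cls l]vadd0 vaddC.
  by move/vaddI.
have [ps [L [pS Hps uL]]] := class_split S.
have wL : w = csum L by rewrite /w (csum_perm pS) csum_cat csum_pairs ?vadd0.
have HL : w \notin map cls L.
  apply/mapP => -[l lL E]; have := Hw l; rewrite (perm_mem pS) mem_cat lL orbT E eqxx.
  by move/(_ isT).
have sps : (10 * m + 1 = 2 * size ps + size L)%N.
  by rewrite -sS -size_flat -size_cat; apply: perm_size.
have [leL|gtL] := leqP (size L) 3.
  apply: (has_block_perm pS); rewrite (_ : (8 * m)%N = (2 * (4 * m))%N); last by rewrite mulnA.
  apply: has_block_pairs => // [p pps|]; last first.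
    by move: sps leL; move: m (size _) (size _) => a b d; clear; lia.
  have pB : {subset [:: p.1; p.2] <= S}.
    move=> u up; rewrite (perm_mem pS) mem_cat; apply/orP; left.
    by apply/flattenP; exists [:: p.1; p.2] => //; apply: map_f.
  by apply: cls_pair_value; rewrite ?Hps // HS // pB // !inE eqxx ?orbT.
have sL8 := uniqV_size uL; rewrite size_map in sL8.
have [sL|sL] : size L = 5%N \/ size L = 7%N.
- by move: sps gtL sL8; move: m (size _) (size _) => a b d; clear; lia.
- by case/negP: HL; rewrite wL; apply: uniqV_sum5; rewrite ?size_map.
have /andP[cL lineL] : (2 < count fst (map cls L))%N &&
    subV (map cls L) (fun q => (size q == 3%N) && (vsum q == vsum (map cls L))).
  by apply: uniqV_line; rewrite ?size_map.
have outS : (2 < count fst S)%N.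
  apply: leq_trans cL _; rewrite (seq.permP pS) count_cat count_map.
  by apply: leq_trans (leq_addl _ _).
have [q /andP[/eqP sq /eqP qw] Hq] := subV_seq lineL.
have [t /perm_map_split[L1 [L2 [pL qE _]]]] := Hq _ (perm_refl _).
pose P U := exists Y U', [/\ perm_eq U (Y ++ U'), size Y = 3%N & csum Y = w].
have PS : P S.
  exists L1, (flat ps ++ L2); split.
  - by rewrite (perm_trans pS) // perm_sym perm_catCA perm_cat2l perm_sym.
  - by rewrite -(size_map cls) -qE.
  by rewrite wL /csum -qE.
have [F [U [pFU Fb [Y [U' [pU sY cY]]] sF grow]]] := greedy_growth zM HS PS.
have HFU := inB_perm pFU HS; have [HF HU] := inB_cat HFU.
have [HY HU'] := inB_cat (inB_perm pU HU).
have pS' : perm_eq S (flatten F ++ Y ++ U') by rewrite (perm_trans pFU) // perm_cat2l.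
have [/andP[_ szF] szF'] := size_unit_blocks Fb.
have szE : (10 * m = size (flatten F) + 2 + size U')%N.
  have : (10 * m + 1 = size (flatten F) + (3 + size U'))%N.
    by rewrite -sS -sY -!size_cat; apply: perm_size.
  by move: m (size _) (size _) => a b d; clear; lia.
have [full|nfull] := leqP m #|sg (map bval F)|; last first.
  have [zH HM Hm sz] := not_full Fb HF sF nfull; set H := stab _ in grow zH HM Hm sz.
  have cU' : compat H U'.
    apply: no_growth_compat; first exact: (proj1 zH).
    move=> x U1 xb pU'; apply: (grow x (Y ++ U1)) => //; last by exists Y, U1.
    by rewrite (perm_trans pU) // perm_sym perm_catCA perm_cat2l perm_sym.
  have szU' : (8 * m + 2 * #|H| <= size U')%N.
    by move: szE sz; move: #|H| m (size _) (size _) => a b d e; clear; lia.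
  (* [U'] is one element short of the bound in [smaller_subgroup]; a compatible point of the line
     supplies it. *)
  case: (classic (exists2 y, y \in Y & compat H (y :: U'))) => [[y yY cy]|N].
    have [Y' pY] := perm_extract yY.
    apply: (has_block_sub (S1 := y :: U') (S2 := flatten F ++ Y')).
      rewrite (perm_trans pS') // (perm_trans (_ : perm_eq _ (flatten F ++ (y :: Y') ++ U'))) //.
        by rewrite perm_cat2l perm_cat2r.
      by rewrite perm_catCA [X in perm_eq _ X]/= perm_cons perm_sym catA perm_catC catA perm_catC perm_catCA.
    by apply: (smaller_subgroup zH HM Hm cy) => /=; rewrite addn1 ltnS.
  have [||||S1 [R [pS1 sR S1c]]] := nearly_single_class zH sY cY _ _ cU' _ _.
  - by move=> u uYU; apply: Hw; rewrite (perm_mem pS') mem_cat uYU orbT.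
  - by move: szU' m_gt1; move: #|H| m (size _) => a b d; clear; lia.
  - by move=> y yY cy; apply: N; exists y.
  - move=> x U1 xb pYU PU1; apply: (grow x U1 xb) => //.
    exact: perm_trans pU pYU.
  have US1 : {subset S1 <= U'} by move=> u uS1; rewrite (perm_mem pS1) mem_cat uS1.
  apply: (has_block_perm pS'); do 2!apply: has_block_catr.
  apply: (has_block_sub pS1); apply: (single_class_case zH HM) => //.
  - exact: compat_sub cU'.
  - exact: inB_sub HU'.
  apply: leq_trans szU' _; rewrite (perm_size pS1) size_cat leq_add2l //.
have le := card_sg_le zM (unit_blocks_halves zM Fb HF).
have sFm : (size F < m)%N by apply: leq_trans sF le.
(* A signed word needs an element outside the abelian part. If [Y] holds all of them, either [U']
   has a single class and Gao's theorem over [M] applies to its translates, or an exchange of lines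
   moves an element of [Y] into the remainder. *)
have [hs|] := boolP (has fst (flatten F ++ U')); first exact: (odd_of_line HS sS pS').
rewrite has_cat negb_or => /andP[nF nU'].
have Y1 : all fst Y.
  rewrite all_count eqn_leq count_size sY /=; apply: leq_trans outS _.
  rewrite (seq.permP pS') !count_cat.
  have c0' T : ~~ has fst T -> count fst T = 0%N by rewrite has_count; case: count.
  by rewrite (c0' _ nF) (c0' _ nU') add0n addn0.
have szU' : (8 * m + m <= (size U').+1)%N.
  move: (szF' nF) szE sFm; move: m (size _) (size _) (size _) => a b d e; clear; lia.
have [a aU'] : exists a, a \in U'.
  case: (U') szU' => [|a ?]; last by exists a; rewrite mem_head.
  by move: m_gt1; move: m => k /=; clear; lia.
have [/allP alleq|/allPn[b bU' nab]] := boolP (all (fun u => cls u == cls a) U').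
  have [||V [R [pV sV V0]]] := gao_multiple (T := map (fun u => u.2 - a.2) U')
      (j := 8) zM (davenport_card zM) (zsub_gt0 zM).
  - apply/allP => _ /mapP[u uU' ->].
    by have [] := cls_eq (HU' _ uU') (HU' _ aU') (eqP (alleq u uU')).
  - by rewrite size_map.
  have [S1 [S2 [pS1 VE _]]] := perm_map_split pV.
  apply: (has_block_perm pS'); do 2!apply: has_block_catr.
  have sS1 : size S1 = (8 * m)%N by rewrite -sV VE size_map.
  exists S1, S2; split=> //; rewrite dihprod_abelian; last first.
    by move: nU'; rewrite (eq_has_r (perm_mem pS1)) has_cat negb_or => /andP[].
  (* Undoing the translation costs [8 m] times [a.2], which vanishes because [a.2 *+ 2] lies in
     [M]. *)
  congr (_, _); move: V0; rewrite VE big_map sum_sub_const sS1.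
  rewrite (_ : (8 * m)%N = (2 * m * 4)%N); last by rewrite mulnAC.
  have Ma : a.2 *+ 2 \in M by have := HU' a aU'; rewrite inE.
  by rewrite !mulrnA (zsub_card_mul zM Ma) mul0rn subr0.
have nF1 u : u \in U' -> u.1 = false.
  by move=> uU'; apply/negP => u1; case/negP: nU'; apply/hasP; exists u.
have [U2 pU2] : exists U2, perm_eq U' (b :: a :: U2).
  by apply: perm_extract2 => //; apply: contra nab => /eqP->.
have [|y [Z [R [pZ yY sZ cZ]]]] := exchange_line sY cY _ nab.
  move=> u uYU; apply: Hw; rewrite (perm_mem pS') !mem_cat.
  by move: uYU; rewrite !inE => /or3P[/eqP->|/eqP->|->]; rewrite ?bU' ?aU' ?orbT.
apply: (odd_of_line (Y := Z) (U := y :: R ++ U2) HS sS _ sZ cZ Fb sFm full).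
  rewrite (perm_trans pS') // perm_cat2l (@perm_trans _ (Y ++ [:: b; a] ++ U2)) //.
    by rewrite perm_cat2l.
  rewrite catA (perm_trans (_ : perm_eq _ ((y :: Z ++ R) ++ U2))) ?perm_cat2r //.
  by rewrite /= -catA -cat1s perm_catCA.
by rewrite has_cat /= (allP Y1) ?orbT.
Qed.

End Step.

Theorem dihedral_blocks M S : zsub M -> doubles M -> compat M S ->
  (10 * #|M| + 1 <= size S)%N -> has_block (8 * #|M|) S.
Proof.
have [k] := ubnP #|M|; elim: k => // k IH in M S *; rewrite ltnS => Mk zM dM cS sS.
have [c [cD c0]] := class_map zM (card_halves dM).
suff H S0 : {in S0, forall u, u.2 \in halves M} -> size S0 = (10 * #|M| + 1)%N ->
    has_block (8 * #|M|) S0.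
  have [S1 [S2 [pS sS1]]] := take_perm sS; apply: (has_block_sub pS).
  have {pS}cS1 : compat M S1.
    by apply: compat_sub cS => u uS; rewrite (perm_mem pS) mem_cat uS.
  (* The shift by [- b] moves one outside element to [y]; compatibility then puts all second
     components into the halves of [M]. The default [0] occurs only if no element lies outside. *)
  pose b := if [seq u.2 | u <- S1 & u.1] is b :: _ then b else 0.
  apply: (@has_block_shift _ (- b)); apply: H; last by rewrite size_map.
  move=> _ /mapP[[[] a] aS ->] /=; rewrite inE; last exact: (proj1 cS1).
  have : a \in [seq u.2 | u <- S1 & u.1].
    by apply/mapP; exists (true, a); rewrite // mem_filter.
  rewrite {}/b; case E: [seq u.2 | u <- S1 & u.1] => [|b l] // _.
  have /mapP[[[] b']] : b \in [seq u.2 | u <- S1 & u.1] by rewrite E mem_head.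
    by rewrite mem_filter /= => bS ->; apply: (proj2 cS1).
  by rewrite mem_filter.
move=> HS sS0; have := zsub_gt0 zM; rewrite leq_eqVlt => /orP[/eqP m1|m1].
  by rewrite -m1; apply: (base_case zM cD c0); rewrite // sS0 -m1.
apply: (odd_case zM dM cD c0) => // H zH HM Hm T cT sT.
by apply: IH => //; [apply: leq_trans Hm Mk|apply: doubles_sub dM].
Qed.

End DihedralTheorem.

(** * The group [D_2n x C_2] *)

Section Products.

Variable gT : finGroupType.
Implicit Types S T U : seq gT.
Local Open Scope group_scope.

Lemma prod_tuple_perm S T : perm_eq S T ->
  exists s : 'S_(size T), \prod_(x <- S) x = \prod_(i < size T) nth 1 T (s i).
Proof.
move=> p; have /tuple_permP[s E] : perm_eq S (in_tuple T) by [].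
exists s; rewrite E big_map /= enumT; apply: eq_bigr => i _.
by rewrite (tnth_nth 1).
Qed.

Lemma perm_products S T : perm_eq S T -> \prod_(x <- S) x \in products T.
Proof. by move=> /prod_tuple_perm[s ->]; apply: imset_f. Qed.

Lemma productsP g T :
  reflect (exists2 S, perm_eq S T & \prod_(x <- S) x = g) (g \in products T).
Proof.
apply: (iffP imsetP) => [[s _ ->]|[S p <-]].
  exists [tuple tnth (in_tuple T) (s i) | i < size T].
    by apply/(@tuple_permP _ _ _ (in_tuple T)); exists s.
  by rewrite big_map /= enumT; apply: eq_bigr => i _; rewrite (tnth_nth 1).
by have [s E] := prod_tuple_perm p; exists s.
Qed.

(** Append [#|gT| - 1] identities to a free sequence: a product-one subsequence of length [#|gT|]
    would, with its identities erased, be a non-empty product-one subsequence of the free one. This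
    bounds [E] from below and [d] from above. *)
Lemma free_forces k l : has_free_length gT k -> forces_product_one gT l ->
  (k + #|gT| <= l)%N.
Proof.
case=> S sS free [l0 H]; rewrite leqNgt; apply/negP => lt.
have g0 : (0 < #|gT|)%N by apply/card_gt0P; exists 1.
have [|T [sub sT /productsP[T' pT T1]]] := H (S ++ nseq #|gT|.-1 1).
  by rewrite size_cat size_nseq sS; move: lt; move: #|gT| g0 => a; clear; lia.
have one_S : 1 \notin S.
  apply/negP => S1; have sub1 : subseq [:: 1] S by rewrite sub1seq.
  have /negP[] := free _ sub1 isT.
  by apply/productsP; exists [:: 1]; rewrite ?big_seq1.
have fE : filter (predC1 1) (S ++ nseq #|gT|.-1 1) = S.
  rewrite filter_cat (@eq_in_filter _ _ predT S) ?filter_predT => [|x xS].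
    by elim: #|gT|.-1 => [|j IH]; rewrite ?cats0 //= eqxx.
  by rewrite /= (memPn one_S).
have sub' : subseq (filter (predC1 1) T) S.
  by rewrite -[X in subseq _ X]fE; rewrite subseq_filter filter_all;
    apply: subseq_trans sub; apply: filter_subseq.
have /negP[] : 1 \notin products (filter (predC1 1) T).
  apply: free => //; apply/negP => /eqP F0.
  have c1 : count_mem 1 T = #|gT|.
    rewrite -sT -(count_predC (pred1 1) T) -[X in (_ + X)%N]size_filter.
    by rewrite (_ : filter _ T = [::]) ?addn0.
  have := leq_count_subseq (pred1 (1 : gT)) sub; rewrite c1 count_cat (count_memPn one_S).
  by rewrite count_nseq /= eqxx mul1n; move: #|gT| g0 => a; clear; lia.
apply/productsP; exists (filter (predC1 1) T'); first exact: perm_filter.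
by rewrite big_filter big_mkcond -[RHS]T1; apply: eq_bigr => x _ /=; case: eqP.
Qed.

End Products.

Lemma dihedral_generators n : (1 < n)%N -> exists x y : 'D_(2 * n),
  [/\ #[x]%g = n, y \notin <[x]>%g, (y ^+ 2 = 1)%g & (x ^ y = x^-1)%g].
Proof.
rewrite mul2n => n1; have := homg_refl [set: 'D_n.*2].
rewrite Grp_dihedral // => /existsP[[x y]] /=; rewrite !xpair_eqE.
case/andP=> /eqP gen /and3P[/eqP xn /eqP y2 /eqP xy].
have ox : (#[x]%g %| n)%N by rewrite order_dvdn xn.
have oy : (#[y]%g %| 2)%N by rewrite order_dvdn y2.
have nxy : (<[y]> \subset 'N(<[x]>))%g.
  by rewrite cycle_subG; apply/normP; rewrite -cycleJ xy cycleV.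
have cG : #|(<[x]> * <[y]>)%g| = (2 * n)%N.
  by rewrite -norm_joinEr // gen cardsT -mul2n; have := card_dihedral n1; rewrite cardsT mul2n.
(* The product of the two cyclic groups has [2 n] elements, while their orders are at most [n] and
   [2]; so both orders are attained and the intersection is trivial. *)
have oxn : #[x]%g = n /\ y \notin <[x]>%g.
  have lx : (#[x]%g <= n)%N by apply: dvdn_leq ox; lia.
  have ly : (#[y]%g <= 2)%N by apply: dvdn_leq oy.
  have i0 : (0 < #|(<[x]> :&: <[y]>)%g|)%N by rewrite cardG_gt0.
  have := mul_cardG <[x]>%G <[y]>%G; rewrite cG -!orderE => E.
  split; first by move: E lx ly i0 n1; move: #[x]%g #[y]%g #|_| => a b d; clear; nia.
  apply/negP => yx; have yI : <[y]>%g \subset (<[x]> :&: <[y]>)%g.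
    by rewrite subsetI cycle_subG yx subxx.
  have := subset_leq_card yI; rewrite -orderE => oyI.
  have y0 := order_gt0 y.
  move: E lx ly i0 n1 oyI y0; move: #[x]%g #[y]%g #|_| => a b d; clear; nia.
by exists x, y; case: oxn.
Qed.

Definition CnxC2 (n : nat) : Type := ('Z_n * 'Z_2)%type.
HB.instance Definition _ n := Finite.on (CnxC2 n).
HB.instance Definition _ n := GRing.Zmodule.on (CnxC2 n).

(** * Identification with a generalized dihedral group, and the two bounds *)

Section Model.

Variable n : nat.
Hypothesis n_gt1 : (1 < n)%N.

Local Notation gT := (dihedral_x_C2 n).
Local Notation A := (CnxC2 n : finZmodType).
Local Notation D := (bool * A)%type.

Lemma val_Zn (i : 'Z_n) : (i < n)%N.
Proof. by rewrite -[X in (_ < X)%N](Zp_cast n_gt1). Qed.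

(** Inversion is trivial on [C_2], so the direct factor can be absorbed into the abelian part. *)
Lemma dihedral_model : exists2 f : D -> gT, bijective f
  & {morph f : u v / dihmul u v >-> (u * v)%g}.
Proof.
have [x [y [ox nyx y2 xy]]] := dihedral_generators n_gt1.
pose f (u : D) : gT := ((x ^+ (u.2.1 : 'Z_n) * y ^+ u.1)%g, u.2.2).
have xn : (x ^+ n = 1)%g by apply/eqP; rewrite -order_dvdn ox.
have xmod k : (x ^+ (k %% n) = x ^+ k)%g by rewrite expg_mod.
have xD (i j : 'Z_n) : (x ^+ (i + j)%R = x ^+ i * x ^+ j)%g.
  rewrite -expgnDr -[in RHS]xmod; congr (x ^+ _)%g.
  by congr (_ %% _)%N; apply: Zp_cast n_gt1.
have xN (i : 'Z_n) : (x ^+ (- i)%R = x ^- i)%g.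
  by apply: (mulgI (x ^+ i)%g); rewrite mulgV -xD subrr.
have yx (i : 'Z_n) : (y * x ^+ i = x ^- i * y)%g.
  have yV : (y^-1 = y)%g by apply: (mulgI y); rewrite mulgV -[RHS]/(y ^+ 2)%g y2.
  have -> : (x ^- i = (x ^+ i) ^ y)%g by rewrite conjXg xy expVgn.
  by rewrite conjgE yV -!mulgA -[(y * y)%g]/(y ^+ 2)%g y2 mulg1.
have fM : {morph f : u v / dihmul u v >-> (u * v)%g}.
  move=> [e [i j]] [e' [i' j']]; congr (_, _); last first.
    by case: e => //=; apply/val_inj; case: j j' => [[|[|?]] ?] [[|[|?]] ?].
  case: e; last first.
    change ((x ^+ (i + i')%R * y ^+ e' = x ^+ i * 1 * (x ^+ i' * y ^+ e'))%g).
    by rewrite xD mulg1 mulgA.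
  change ((x ^+ (i - i')%R * y ^+ (~~ e') = x ^+ i * y * (x ^+ i' * y ^+ e'))%g).
  rewrite xD xN -!mulgA; congr (_ * _)%g; rewrite mulgA yx -mulgA; congr (_ * _)%g.
  by case: e' => /=; rewrite ?mulg1 // -[RHS]/(y ^+ 2)%g y2.
exists f => //; apply: inj_card_bij.
  move=> [e [i j]] [e' [i' j']] [E ->].
  have y_out k (l : 'Z_n) (h : 'Z_n) : (x ^+ k * y ^+ true = x ^+ h)%g -> False.
    move=> /(canRL (mulKg _)) yE; case/negP: nyx.
    by rewrite -[y]expg1 yE groupM ?groupV ?mem_cycle.
  have xI (k l : 'Z_n) : (x ^+ k = x ^+ l)%g -> k = l.
    move/eqP; rewrite eq_expg_mod_order ox !modn_small ?val_Zn // => /eqP.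
    exact: val_inj.
  case: e e' E => [] [] /=; rewrite ?mulg1.
  - by move=> /mulIg/xI->.
  - by move=> /y_out; case.
  - by move=> /esym/y_out; case.
  by move=> /xI->.
have := card_dihedral n_gt1; rewrite cardsT -mul2n => cD.
rewrite card_prod cD !card_prod card_bool !card_ord (Zp_cast n_gt1).
by rewrite mulnA.
Qed.

Hypothesis n_even : ~~ odd n.

Lemma mulr2_ZnE (i : 'Z_n) : (i *+ 2 == 0) = (i \in [:: 0; inZp n./2]).
Proof.
have ni := val_Zn i; have nE := even_halfK n_even.
have val2 : (i *+ 2 : 'Z_n) = ((i + i) %% n)%N :> nat.
  by congr (_ %% _)%N; apply: Zp_cast n_gt1.
have valh : (inZp n./2 : 'Z_n) = n./2 :> nat.
  by rewrite /= (Zp_cast n_gt1) modn_small //; move: n_gt1 nE; move: n n./2 => a b; clear; lia.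
have -> : (i *+ 2 == 0) = (n %| i + i)%N by rewrite -(inj_eq val_inj) /dvdn -val2.
have -> : (i \in [:: 0; inZp n./2]) = ((i == 0%N :> nat) || (i == n./2 :> nat)).
  by rewrite !inE -!(inj_eq val_inj) -[in RHS]valh.
rewrite addnn -muln2 -[X in (X %| _)%N]nE -muln2 dvdn_pmul2r //.
have [lt|ge] := ltnP i n./2.
  rewrite (ltn_eqF lt) orbF; by case: (nat_of_ord i) lt => [|k] lt; rewrite ?dvdn0 ?gtnNdvd.
apply/idP/orP => [/dvdnP[q qE]|[/eqP->|/eqP->] //].
move: ni ge; rewrite qE -nE -muln2; case: q {qE} => [|[|q]]; [by left| |].
  by rewrite mul1n; right.
by move: n./2 => a; clear; nia.
Qed.

Lemma two_torsion_CnxC2 : #|[set a : A | a *+ 2 == 0]| = 4%N.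
Proof.
have E (a : A) : (a *+ 2 == 0) = (a.1 \in [:: 0; inZp n./2]).
  by case: a => i [[|[|//]] ?]; rewrite -mulr2_ZnE xpair_eqE /= andbT.
have := cardX (mem ([:: 0; inZp n./2] : seq 'Z_n)) (mem (predT : pred 'Z_2)).
rewrite card_ord (card_uniqP _) /=; last first.
  have nE := even_halfK n_even; rewrite inE andbT -(inj_eq val_inj) /= (Zp_cast n_gt1).
  by rewrite modn_small; move: n_gt1 nE; move: n n./2 => a b; clear; lia.
move=> E4; apply: etrans E4; apply: eq_card => a.
by rewrite inE E !inE /= !unfold_in orbF andbT.
Qed.

Lemma cyclic_doubles_CnxC2 : exists g : A, forall a : A, exists i, a *+ 2 = g *+ i.
Proof.
exists ((1 : 'Z_n) *+ 2, 0 : 'Z_2) => -[i j]; exists (i : nat).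
have E (k : nat) (u : 'Z_n) (v : 'Z_2) : ((u, v) : A) *+ k = (u *+ k, v *+ k).
  by elim: k => [|k IH]; rewrite ?mulr0n // !mulrS IH.
rewrite !E mul0rn; congr (_, _); first by rewrite -mulrnA mulnC mulrnA natr_Zp.
by case: j => [[|[|//]] ?]; apply: val_inj.
Qed.

Let C : {set A} := [set a *+ 2 | a in [set: A]].

Lemma card_doubles : #|C| = n./2.
Proof.
have dC : doubles C by move=> _ /imsetP[a _ ->]; exists a.
have := card_halves two_torsion_CnxC2 dC.
have -> : halves C = [set: A]
  by apply/setP => a; rewrite in_setT inE; apply/imsetP; exists a; rewrite ?in_setT.
rewrite cardsT card_prod !card_ord (Zp_cast n_gt1).
by rewrite -[(Zp_trunc 2).+2]/2%N; have := even_halfK n_even; move: n n./2 #|C| => a b d; clear; lia.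
Qed.

Lemma forces_5n1 : forces_product_one gT (5 * n + 1).
Proof.
split=> [|S sS]; first by rewrite addn1.
have [f [g fK gK] fM] := dihedral_model; have nE := even_halfK n_even.
have f1 : f (false, 0) = 1%g.
  by apply: (mulgI (f (false, 0))); rewrite -fM mulg1 dihmul0.
have fprod T : f (dihprod T) = (\prod_(x <- map f T) x)%g.
  by elim: T => [|u T IH]; rewrite ?big_nil //= big_cons fM IH.
have zC : zsub C.
  split=> [|_ _ /imsetP[a _ ->] /imsetP[b _ ->]]; apply/imsetP.
    by exists 0; rewrite ?mul0rn ?inE.
  by exists (a - b); rewrite ?mulrnBl ?inE.
have dC : doubles C by move=> _ /imsetP[a _ ->]; exists a.
(* For [M = C], the group of all doubles, compatibility is automatic; since [#|C|] is half of [n],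
   the lengths become [4 n], the group order, and [5 n + 1]. *)
have [||T [R [pT sT T1]]] := dihedral_blocks two_torsion_CnxC2 cyclic_doubles_CnxC2 zC dC
    (S := map g S).
- by split=> *; apply: imset_f; rewrite inE.
- by rewrite size_map card_doubles; move: sS nE; move: n n./2 (size S) => a b d; clear; lia.
have [|T' subT' pT'] := (count_subseqP (map f T) S).1.
  move=> x; have /seq.permP-> : perm_eq S (map f (T ++ R)).
    by rewrite -(mapK gK S); apply: perm_map.
  by rewrite map_cat count_cat leq_addr.
exists T'; split=> //.
  rewrite -(perm_size pT') size_map sT card_doubles -(bij_eq_card (Bijective fK gK)).
  rewrite !card_prod card_bool !card_ord (Zp_cast n_gt1).
  by rewrite -[(Zp_trunc 2).+2]/2%N; move: nE; move: n n./2 => a b; clear; lia.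
by rewrite -f1 -T1 fprod; apply: perm_products.
Qed.

(* x^(n-1), y and the generator of the second factor *)
Lemma free_n1 : has_free_length gT (n + 1).
Proof.
have [f [g fK gK] fM] := dihedral_model.
have f1 : f (false, 0) = 1%g.
  by apply: (mulgI (f (false, 0))); rewrite -fM mulg1 dihmul0.
have fprod T : f (dihprod T) = (\prod_(x <- map f T) x)%g.
  by elim: T => [|u T IH]; rewrite ?big_nil //= big_cons fM IH.
pose a : D := (false, (1 : 'Z_n, 0 : 'Z_2)); pose b : D := (false, (0 : 'Z_n, 1 : 'Z_2)).
pose S0 : seq D := nseq n.-1 a ++ [:: b; (true, 0)].
exists (map f S0).
  by rewrite size_map size_cat size_nseq /=; move: n_gt1; move: n => k; clear; lia.
move=> T /subseqP[mk _ ->]; rewrite -map_mask; set T0 := mask mk S0 => T0n.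
have T0S : subseq T0 S0 by apply: mask_subseq.
apply/negP => /productsP[T' pT'].
have {pT'} [U pU ->] : exists2 U, perm_eq U T0 & T' = map f U.
  by exists (map g T'); [rewrite -(mapK fK T0); apply: perm_map|rewrite (mapK gK)].
rewrite -fprod -f1 => /(can_inj fK) U1.
have cU p : (count p U <= count p S0)%N by rewrite (seq.permP pU) leq_count_subseq.
(* The product lies in the abelian part, so the number of outside letters is even; only one is
   available. *)
have nU : ~~ has fst U.
  have := dihprod_parity U; have := cU fst; rewrite U1 has_count count_cat count_nseq /=.
  by case: (count fst U) => [|[|]].
have Uab : {in U, forall u, u \in [:: a; b]}.
  move=> u uU; have : u \in S0 by apply: (mem_subseq T0S); rewrite -(perm_mem pU).
  rewrite mem_cat mem_nseq !inE => /orP[/andP[_ ->] //|/orP[->|/eqP uE]]; rewrite ?orbT //.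
  by case/negP: nU; apply/hasP; exists u; rewrite // uE.
have ab : (a == b) = false by apply/eqP => -[].
have sumU W : {in W, forall u, u \in [:: a; b]} ->
    \sum_(u <- W) u.2 = ((count_mem a W)%:R, (count_mem b W)%:R) :> A
    /\ size W = (count_mem a W + count_mem b W)%N.
  elim: W => [|u W IH] HW; first by rewrite big_nil.
  have [|E1 E2] := IH; first by move=> v vW; apply: HW; rewrite inE vW orbT.
  have := HW u (mem_head _ _); rewrite big_cons E1 /= E2 !inE => /orP[]/eqP->.
    rewrite eqxx ab !addnA addn0; split=> //.
    transitivity ((1 + (count_mem a W)%:R, 0 + (count_mem b W)%:R) : A) => //.
    by congr (_, _); rewrite ?mulrnDr ?add0r.
  rewrite eqxx [b == a]eq_sym ab add0n addnCA; split=> //.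
  transitivity ((0 + (count_mem a W)%:R, 1 + (count_mem b W)%:R) : A) => //.
  by congr (_, _); rewrite ?mulrnDr ?add0r.
have [E sU] := sumU U Uab.
move: U1; rewrite dihprod_abelian // E => -[Ea Eb].
have ca : count_mem a U = 0%N.
  have := cU (pred1 a); rewrite count_cat count_nseq /= mul1n !addn0 => le.
  have /(congr1 val) := Ea; rewrite /= val_Zp_nat // modn_small //.
  by move: le n_gt1; move: n (count _ U) => p q; clear; lia.
have cb : count_mem b U = 0%N.
  have := cU (pred1 b); rewrite count_cat count_nseq /= mul0n !addn0.
  by move: Eb; case: (count _ U) => [|[|]].
move: T0n; rewrite -size_eq0 size_map -(perm_size pU) sU ca cb; done.
Qed.

End Model.

Local Close Scope ring_scope.

Theorem theorem4p2 (n : nat) (n_ge4 : 4 <= n) (n_even : ~~ odd n) :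
  [/\ gao_constant (dihedral_x_C2 n) = 5 * n + 1,
      small_davenport (dihedral_x_C2 n) = n + 1
    & gao_constant (dihedral_x_C2 n)
      = small_davenport (dihedral_x_C2 n) + #|dihedral_x_C2 n| ].
Proof.
have n_gt1 : (1 < n)%N by apply: leq_trans n_ge4.
have cG : #|dihedral_x_C2 n| = (4 * n)%N.
  have := card_dihedral n_gt1; rewrite cardsT -mul2n card_prod card_ord => ->.
  by rewrite -[(Zp_trunc 2).+2]/2%N; lia.
have F := forces_5n1 n_gt1 n_even; have S := free_n1 n_gt1.
(* Both values are squeezed by [free_forces]: [F] bounds [E] from above and, through it, [d]; [S]
   bounds [d] from below and, through it, [E]. *)
have gE : gao_constant (dihedral_x_C2 n) = (5 * n + 1)%N.
  rewrite /gao_constant; case: ex_minnP => l /sumboolP Fl lmin.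
  have le := lmin (5 * n + 1)%N; have := free_forces S Fl; rewrite cG => ge.
  suff : (l <= 5 * n + 1)%N by move: ge; clear; lia.
  by apply: le; apply/sumboolP.
have dE : small_davenport (dihedral_x_C2 n) = (n + 1)%N.
  rewrite /small_davenport; case: ex_maxnP => k /sumboolP Sk kmax.
  have ge : (n + 1 <= k)%N by apply: kmax; apply/sumboolP.
  by have := free_forces Sk F; rewrite cG; move: ge; clear; lia.
by split; rewrite // gE dE cG; clear; lia.
Qed.
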